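(* We have (a) $$\frac{1}{1-t}+\sum_{n=1}^\infty\frac{(1+yt)^n}{(1-t)^{n+1}}F_n^{(\mathrm{lpk},\mathrm{des})}\left(\frac{(1+y)^2t}{(y+t)(1+yt)},\frac{y+t}{1+yt},z_1,z_2,\dots\right)x^n$$ $$=\sum_{k=0}^\infty t^k\prod_{i=1}^\infty\exp\left(\sum_{m_i=1}^\infty\frac{(z_ix^i)^{m_i}}{im_i}\sum_{d\mid i}\mu(d)\bigl(1+k(1-(-y)^{dm_i})\bigr)^{i/d}\right)$$ and (b) $$\frac{1}{1-t}+\sum_{n=1}^\infty\frac{(1+t)^n}{(1-t)^{n+1}}F_n^{\mathrm{lpk}}\left(\frac{4t}{(1+t)^2},z_1,z_2,\dots\right)x^n=\sum_{k=0}^\infty\frac{t^k}{1-z_1x}\prod_{i=1}^\infty\left(\frac{1+z_ix^i}{1-z_ix^i}\right)^{h_{i,k}}.$$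
   Context: For a permutation $\pi=\pi(1)\cdots\pi(n)$ of $[n]=\{1,\dots,n\}$, $\mathrm{des}(\pi)$ is the number of descents, i.e. $i\in[n-1]$ with $\pi(i)>\pi(i+1)$; an index $i\in[n-1]$ is a left peak if either $2\le i\le n-1$ and $\pi(i-1)<\pi(i)>\pi(i+1)$, or $i=1$ and $\pi(1)>\pi(2)$, and $\mathrm{lpk}(\pi)$ is the number of left peaks; $N_i(\pi)$ is the number of cycles of length $i$ of $\pi$. $\mathfrak{S}_n$ is the set of all permutations of $[n]$. With variables $z_1,z_2,\dots$, put $$F_n^{(\mathrm{lpk},\mathrm{des})}(y,t,z_1,z_2,\dots)=\sum_{\pi\in\mathfrak{S}_n}y^{\mathrm{lpk}(\pi)}t^{\mathrm{des}(\pi)}\prod_{i=1}^\infty z_i^{N_i(\pi)},\qquad F_n^{\mathrm{lpk}}(t,z_1,z_2,\dots)=\sum_{\pi\in\mathfrak{S}_n}t^{\mathrm{lpk}(\pi)}\prod_{i=1}^\infty z_i^{N_i(\pi)}.$$ Also $$h_{i,k}=\begin{cases}\dfrac{(1+2k)^i-1}{2i},&\text{if }i=2^j\text{ with }j\ge0,\\[2mm]\dfrac1{2i}\displaystyle\sum_{\substack{d\mid i\\ d\text{ odd}}}\mu(d)(1+2k)^{i/d},&\text{otherwise,}\end{cases}$$ where $\mu$ is the number-theoretic Möbius function. The identities are between formal power series in $x$ and $t$; rational functions of $y,t$ are expanded as power series in $t$. *)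

(* Defs.v *)
From HB Require Import structures.
From mathcomp Require Import all_boot all_order all_fingroup all_algebra.
From mathcomp Require Import boolp zify.
From mathcomp Require Import monalg.

Set Implicit Arguments.
Unset Strict Implicit.
Unset Printing Implicit Defensive.

Import GRing.Theory.

Local Open Scope ring_scope.

Record fps (R : Type) := Fps { fcoef : nat -> R }.

Lemma fpsP (R : Type) (f g : fps R) : fcoef f =1 fcoef g -> f = g.
Proof. by case: f g => [f] [g] /= /funext ->. Qed.

HB.instance Definition _ (R : Type) := gen_eqMixin (fps R).
HB.instance Definition _ (R : Type) := gen_choiceMixin (fps R).

Section FpsZmod.
Variable R : zmodType.
Implicit Types f g h : fps R.

Definition fps0 : fps R := Fps (fun=> 0).
Definition fps_opp f : fps R := Fps (fun n => - fcoef f n).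
Definition fps_add f g : fps R := Fps (fun n => fcoef f n + fcoef g n).

Lemma fps_addA : associative fps_add.
Proof. by move=> f g h; apply: fpsP => n /=; rewrite addrA. Qed.
Lemma fps_addC : commutative fps_add.
Proof. by move=> f g; apply: fpsP => n /=; rewrite addrC. Qed.
Lemma fps_add0 : left_id fps0 fps_add.
Proof. by move=> f; apply: fpsP => n /=; rewrite add0r. Qed.
Lemma fps_addN : left_inverse fps0 fps_opp fps_add.
Proof. by move=> f; apply: fpsP => n /=; rewrite addNr. Qed.

HB.instance Definition _ := GRing.isZmodule.Build (fps R)
  fps_addA fps_addC fps_add0 fps_addN.

End FpsZmod.

Section FpsRing.
Variable R : comNzRingType.
Implicit Types f g h : fps R.

Definition fpsC (c : R) : fps R := Fps (fun n => if n == 0%N then c else 0).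
Definition fpsX : fps R := Fps (fun n => (n == 1%N)%:R).
Definition fps_mul f g : fps R :=
  Fps (fun n => \sum_(j < n.+1) fcoef f j * fcoef g (n - j)).

Definition fps_trunc N f : {poly R} := \poly_(i < N) fcoef f i.

Lemma fps_mul_trunc N f g n : (n < N)%N ->
  fcoef (fps_mul f g) n = (fps_trunc N f * fps_trunc N g)`_n.
Proof.
move=> nN; rewrite coefM /=; apply: eq_bigr => j _; rewrite !coef_poly.
have jn : (j <= n)%N by rewrite -ltnS.
by rewrite (leq_ltn_trans jn nN) (leq_ltn_trans (leq_subr _ _) nN).
Qed.

Lemma fps_mulC : commutative fps_mul.
Proof.
by move=> f g; apply: fpsP => n; rewrite !(@fps_mul_trunc n.+1) // mulrC.
Qed.

Lemma fps_mulA : associative fps_mul.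
Proof.
have aux f g h n : fcoef (fps_mul f (fps_mul g h)) n =
    (fps_trunc n.+1 f * (fps_trunc n.+1 g * fps_trunc n.+1 h))`_n.
  rewrite coefM /=; apply: eq_bigr => j _.
  rewrite coef_poly ltn_ord; congr (_ * _).
  by rewrite -(@fps_mul_trunc n.+1) // ltnS leq_subr.
move=> f g h; apply: fpsP => n.
by rewrite aux (fps_mulC (fps_mul f g)) aux mulrA mulrC.
Qed.

Lemma fps_mul1 : left_id (fpsC 1) fps_mul.
Proof.
move=> f; apply: fpsP => n /=; rewrite big_ord_recl /= mul1r subn0.
by rewrite big1 ?addr0 // => j _; rewrite mul0r.
Qed.

Lemma fps_mulDl : left_distributive fps_mul +%R.
Proof.
move=> f g h; apply: fpsP => n /=; rewrite -big_split /=.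
by apply: eq_bigr => j _; rewrite mulrDl.
Qed.

Lemma fps_oner_neq0 : fpsC 1 != 0.
Proof.
apply/eqP => /(congr1 (fun f : fps R => fcoef f 0)) /= /eqP.
by rewrite oner_eq0.
Qed.

HB.instance Definition _ := GRing.Zmodule_isComNzRing.Build (fps R)
  fps_mulA fps_mulC fps_mul1 fps_mulDl fps_oner_neq0.

(* Inverses are unique, so a choice of inverse is the inverse; by
   [fps_unit_const] below, the units are the series whose constant term is
   invertible in R. *)
Definition fps_unit : {pred fps R} := fun f => `[< exists g, g * f = 1 >].
Definition fps_inv f : fps R :=
  if pselect (exists g, g * f = 1) is left e then projT1 (cid e) else f.

Lemma fps_mulVx : {in fps_unit, left_inverse 1 fps_inv *%R}.
Proof.
move=> f /asboolP uf; rewrite /fps_inv.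
by case: pselect => // e; case: (cid e).
Qed.

Lemma fps_unitPl f g : g * f = 1 -> fps_unit f.
Proof. by move=> gf; apply/asboolP; exists g. Qed.

Lemma fps_invr_out : {in [predC fps_unit], fps_inv =1 id}.
Proof.
move=> f nuf; rewrite /fps_inv; case: pselect => // e.
by case/negP: nuf; apply/asboolP.
Qed.

HB.instance Definition _ := GRing.ComNzRing_hasMulInverse.Build (fps R)
  fps_mulVx fps_unitPl fps_invr_out.

Lemma fcoef_sum (I : Type) (r : seq I) (F : I -> fps R) n :
  fcoef (\sum_(i <- r) F i) n = \sum_(i <- r) fcoef (F i) n.
Proof. exact: (big_morph (fun f => fcoef f n)). Qed.

Lemma fcoef_expr0 f k n : fcoef f 0 = 0 -> (n < k)%N -> fcoef (f ^+ k) n = 0.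
Proof.
move=> f0; elim: k n => // k IHk n nk; rewrite exprS /= big_ord_recl /= f0.
rewrite mul0r add0r big1 // => j _; rewrite IHk ?mulr0 //.
by rewrite /bump /=; case: n nk j => [_ [] //|n nk j]; lia.
Qed.

Lemma fps_unit_const f :
  f \is a GRing.unit <-> exists c, c * fcoef f 0 = 1.
Proof.
split=> [uf|[c cf]].
  exists (fcoef f^-1 0); have /(congr1 (fun g => fcoef g 0)) := mulVr uf.
  by rewrite /= big_ord1.
pose e : fps R := 1 - fpsC c * f.
have e0 : fcoef e 0 = 0 by rewrite /= big_ord1 /= cf subrr.
pose s N : fps R := \sum_(k < N) e ^+ k.
pose g : fps R := Fps (fun n => fcoef (s n.+1) n).
have gs N n : (n < N)%N -> fcoef g n = fcoef (s N) n.
  move=> nN; rewrite /g /s /= !fcoef_sum -(subnKC nN) big_split_ord /=.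
  rewrite [X in _ = _ + X]big1 ?addr0 // => k _.
  by rewrite fcoef_expr0 // ltnS leq_addr.
suff ge : g * (1 - e) = 1.
  apply: (@fps_unitPl _ (g * fpsC c)).
  by rewrite -ge -mulrA /e subKr.
apply: fpsP => n.
have -> : fcoef (g * (1 - e)) n = fcoef (s n.+1 * (1 - e)) n.
  rewrite /=; apply: eq_bigr => j _; congr (_ * _).
  exact: gs.
have -> : s n.+1 * (1 - e) = 1 - e ^+ n.+1.
  by rewrite mulrC -opprB mulNr -subrX1 opprB.
have -> : fcoef (1 - e ^+ n.+1) n = fcoef 1 n - fcoef (e ^+ n.+1) n by [].
by rewrite fcoef_expr0 // subr0.
Qed.

End FpsRing.

(** [fps (fps R)] is the ring of formal power series in x and t: the outer
    variable is x, the inner one is t.  A sequence converges when, for all n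
    and m, its coefficients of x^n t^m are eventually constant. *)

Section Convergence.
Variable R : comNzRingType.
Implicit Types (u : nat -> fps (fps R)) (l f : fps (fps R)).

Definition fps_cvg u l := forall n m : nat, exists N0 : nat,
  forall N, (N0 <= N)%N -> fcoef (fcoef (u N) n) m = fcoef (fcoef l n) m.

Definition fps_lim u : fps (fps R) :=
  if pselect (exists l, fps_cvg u l) is left e then projT1 (cid e) else 0.

Lemma fps_cvg_unique u l1 l2 : fps_cvg u l1 -> fps_cvg u l2 -> l1 = l2.
Proof.
move=> h1 h2; apply: fpsP => n; apply: fpsP => m.
have [N1 e1] := h1 n m; have [N2 e2] := h2 n m.
by rewrite -(e1 (maxn N1 N2)) ?leq_maxl // (e2 (maxn N1 N2)) ?leq_maxr.
Qed.

Lemma fps_cvg_lim u l : fps_cvg u l -> fps_lim u = l.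
Proof.
move=> ul; rewrite /fps_lim; case: pselect => [e|]; last by case; exists l.
by apply: fps_cvg_unique ul; case: (cid e).
Qed.

Definition fps_series (a : nat) (F : nat -> fps (fps R)) : fps (fps R) :=
  fps_lim (fun N => \sum_(a <= i < N) F i).

Definition fps_infprod (a : nat) (F : nat -> fps (fps R)) : fps (fps R) :=
  fps_lim (fun N => \prod_(a <= i < N) F i).

End Convergence.

Reserved Notation "\sum_ ( m <= i '<oo' ) F"
  (F at level 41,
   format "'[' \sum_ ( m  <=  i  '<oo' ) '/  '  F ']'").
Reserved Notation "\prod_ ( m <= i '<oo' ) F"
  (F at level 36,
   format "'[' \prod_ ( m  <=  i  '<oo' ) '/  '  F ']'").

Notation "\sum_ ( m <= i '<oo' ) F" := (fps_series m (fun i => F)) : ring_scope.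
Notation "\prod_ ( m <= i '<oo' ) F" :=
  (fps_infprod m (fun i => F)) : ring_scope.

Section ExpLog.
Variable R : comNzRingType.
Implicit Types f : fps (fps R).

(* For f without constant term in x, resp. with constant term 1 in x, over a
   coefficient ring R that contains the rationals. *)
Definition fps_exp f : fps (fps R) := \sum_(0 <= m <oo) (f ^+ m / m`!%:R).
Definition fps_log f : fps (fps R) :=
  \sum_(1 <= m <oo) ((-1) ^+ m.+1 * (f - 1) ^+ m / m%:R).

Definition fps_pow f (a : rat) : fps (fps R) := fps_exp (ratr a * fps_log f).

End ExpLog.

Section Statistics.
Variable n : nat.
Implicit Type p : 'S_n.

(* The letter p(i) of p(1) ... p(n), with values in {1, ..., n}, for
   1 <= i <= n; 'S_n itself permutes {0, ..., n-1}. *)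
Definition letter p (i : nat) : nat :=
  nth 0%N [seq (p j).+1 | j : 'I_n] i.-1.

Definition descent p (i : nat) : bool := (letter p i > letter p i.+1)%N.

Definition left_peak p (i : nat) : bool :=
  [&& (2 <= i)%N, (letter p i.-1 < letter p i)%N
    & (letter p i > letter p i.+1)%N]
  || (i == 1%N) && (letter p 1 > letter p 2)%N.

Definition des p : nat := count (descent p) (index_iota 1 n).
Definition lpk p : nat := count (left_peak p) (index_iota 1 n).
Definition Ncyc p (i : nat) : nat := #|[set C in porbits p | #|C| == i]|.

(* There is no cycle of length i > n, so the products over i stop at n. *)
Definition F_lpk_des (S : comNzRingType) (y t : S) (z : nat -> S) : S :=
  \sum_(p : 'S_n) y ^+ lpk p * t ^+ des p * \prod_(1 <= i < n.+1) z i ^+ Ncyc p i.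

Definition F_lpk (S : comNzRingType) (t : S) (z : nat -> S) : S :=
  \sum_(p : 'S_n) t ^+ lpk p * \prod_(1 <= i < n.+1) z i ^+ Ncyc p i.

End Statistics.

Definition mobius (n : nat) : int :=
  if all (fun p => logn p n == 1%N) (primes n) then (-1) ^+ size (primes n)
  else 0.

(* Since j < 2 ^ j, the exponents j < i suffice to detect i = 2 ^ j. *)
Definition hexp (i k : nat) : rat :=
  if [exists j : 'I_i, i == (2 ^ j)%N] then
    ((1 + 2 * k%:R) ^+ i - 1) / (2 * i%:R)
  else
    (2 * i%:R)^-1 *
    \sum_(d <- divisors i | odd d) (mobius d)%:~R * (1 + 2 * k%:R) ^+ (i %/ d).

(* Rational functions such as 1 / (y + t) have a power series expansion in t
   only once y is inverted, hence the coefficient field Q(y).  The variables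
   of the polynomial ring are indexed by nat; z_0 is not used. *)
Definition Qy : fieldType := {fraction {poly rat}}.
Definition Qyz : comNzRingType := malg (cmonom nat) Qy.
Definition Qyztx : comUnitRingType := fps (fps Qyz).

Definition yvar : Qyztx :=
  fpsC (fpsC (malgC (tofrac ('X : {poly rat})) : Qyz)).
Definition zvar (i : nat) : Qyztx :=
  fpsC (fpsC (mkmalgU (ucm i) (1 : Qy) : Qyz)).
Definition tvar : Qyztx := fpsC (fpsX Qyz).
Definition xvar : Qyztx := fpsX (fps Qyz).

(* Main.v *)
From HB Require Import structures.
Require Import Defs.
From mathcomp Require Import all_boot all_order all_fingroup all_algebra.
From mathcomp Require Import boolp monalg zify ring.

Set Implicit Arguments.
Unset Strict Implicit.
Unset Printing Implicit Defensive.

Import GRing.Theory.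
Local Open Scope ring_scope.

(** Fix k and consider the letters 0 < 1 < ... < 2k, where an even letter has
    weight 1 and an odd letter weight y.  Call a permutation p of n points and
    a word f of n letters compatible when f is weakly increasing, p increases
    on every block of equal even letters, and p decreases on every block of
    equal odd letters.  In both identities, and for y = 1 in (b), the
    coefficient of x^n t^k on either side is the sum over all compatible pairs
    (p, f) of the weight of f times the product of the z_i over the cycles of
    p, i being the length of the cycle.

    On the left, fix p.  Whether two adjacent letters of f may coincide depends
    only on the parity of the letter and on whether p has a descent there.
    Reading f from left to right therefore needs two states, one after an
    ascent and one after a descent, and the four possible transitions multiply
    the generating function in t by 1 + yt, t(1 + y), 1 + y and y + t, each
    divided by 1 - t.  A left peak is a passage from the first state to the
    second, so the product of these factors is the monomial in the statistics
    that appears in (a): [walk_seriesE], [sum_compatible].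

    On the right, the argument is that of Gessel and Reutenauer.  The itinerary
    of a point x is the periodic sequence f(x), f(p(x)), f(p(p(x))), ...  The
    order of the points agrees with a lexicographic order of their itineraries
    that is reversed after every odd letter, and this forces a compatible pair
    to be determined by the number of points of each itinerary
    ([compatible_uniq]), that is, by a multiset of primitive necklaces of total
    length n.  There are as many such multisets as words of length n
    ([card_valid_data]), and every word gives a compatible pair by sorting
    ([compatible_sort]), so the correspondence is bijective ([occ_data_onto]).
    If m points share an itinerary of period l, the l-th power of p permutes
    them in an order preserving or order reversing way, according to the number
    of odd letters in a period; so they lie on m cycles of length l in the
    first case, and in the second case on m/2 cycles of length 2l, rounded
    down, with one more cycle of length l when m is odd ([NcycE]).  Hence the sum over all
    compatible pairs is the coefficient of x^n in a product over necklaces with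
    factors 1/(1 - Z) and (1 + Z)/(1 - Z') ([compatible_sumE]).

    It remains to recognize the exponentials of (a) in this product.  Their
    logarithmic derivatives are compared.  That of the product is a sum over
    periodic sequences; powers of power sums expand over periodic sequences as
    well, the power sums of the weighted alphabet, odd letters counted with a
    sign, are 1 + k(1 - (-y)^q), and Moebius inversion isolates the sequences
    of exact period i ([cycle_coefE]).  A series is determined by its constant
    term and its logarithmic derivative ([euler_inj]).

    Part (b) is the case y = 1.  There the sum over d in (a) depends only on i
    and on the parity of m: it is 2 i h_{i,k} for odd m and 0 for even m, except
    that 1 is added when i = 1 ([cycle_coef_int], [hexp_mul]).  These additional
    terms make up the factor 1/(1 - z_1 x). *)

(** * Coefficients and Euler derivatives of formal power series *)

Section FpsCoef.
Variable R : comNzRingType.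
Implicit Types f g h : fps R.

Lemma fcoefD f g n : fcoef (f + g) n = fcoef f n + fcoef g n.
Proof. by []. Qed.

Lemma fcoefN f n : fcoef (- f) n = - fcoef f n.
Proof. by []. Qed.

Lemma fcoefMn f k n : fcoef (f *+ k) n = fcoef f n *+ k.
Proof. by elim: k => // k IHk; rewrite !mulrS fcoefD IHk. Qed.

Lemma fcoef1 n : fcoef (1 : fps R) n = (n == 0%N)%:R.
Proof. by rewrite /=; case: eqP. Qed.

Lemma fcoefM f g n :
  fcoef (f * g) n = \sum_(j < n.+1) fcoef f j * fcoef g (n - j).
Proof. by []. Qed.

Lemma fcoefM0 f g : fcoef (f * g) 0 = fcoef f 0 * fcoef g 0.
Proof. by rewrite fcoefM big_ord1. Qed.

Lemma fcoefCM c f n : fcoef (fpsC c * f) n = c * fcoef f n.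
Proof.
rewrite fcoefM big_ord_recl /= subn0 big1 ?addr0 // => j _.
by rewrite mul0r.
Qed.

Lemma fcoefXM f n : fcoef (fpsX R * f) n = if n is n'.+1 then fcoef f n' else 0.
Proof.
rewrite fcoefM big_ord_recl /= mul0r add0r.
case: n => [|n]; first by rewrite big_ord0.
rewrite big_ord_recl /= mul1r subSS subn0 big1 ?addr0 // => j _.
by rewrite mul0r.
Qed.

Lemma fcoefXnM f k n :
  fcoef (fpsX R ^+ k * f) n = if (k <= n)%N then fcoef f (n - k) else 0.
Proof.
elim: k n => [|k IHk] n; first by rewrite expr0 mul1r subn0.
by rewrite exprS -mulrA fcoefXM; case: n.
Qed.

Lemma fpsC_zmod : zmod_morphism (@fpsC R).
Proof.
by move=> a b; apply: fpsP => n /=; case: eqP; rewrite ?subr0.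
Qed.

Lemma fpsC_monoid : monoid_morphism (@fpsC R).
Proof.
split=> // a b; apply: fpsP => n.
by rewrite fcoefCM /=; case: eqP; rewrite ?mulr0.
Qed.

HB.instance Definition _ :=
  GRing.isZmodMorphism.Build R (fps R) (@fpsC R) fpsC_zmod.
HB.instance Definition _ :=
  GRing.isMonoidMorphism.Build R (fps R) (@fpsC R) fpsC_monoid.

Lemma fps_unit0 f : fcoef f 0 = 1 -> f \is a GRing.unit.
Proof. by move=> f0; apply/fps_unit_const; exists 1; rewrite f0 mulr1. Qed.

(** Congruence modulo x^N. *)
Definition feq N f g := forall n, (n < N)%N -> fcoef f n = fcoef g n.

Lemma feqM N f f' g g' : feq N f f' -> feq N g g' -> feq N (f * g) (f' * g').
Proof.
move=> ff gg n nN; rewrite !fcoefM; apply: eq_bigr => j _.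
rewrite ff ?gg //; first exact: leq_ltn_trans (leq_subr _ _) nN.
exact: leq_ltn_trans (leq_ord j) nN.
Qed.

Lemma feq_prod N (I : Type) (r : seq I) (P : pred I) (F G : I -> fps R) :
  (forall i, P i -> feq N (F i) (G i)) ->
  feq N (\prod_(i <- r | P i) F i) (\prod_(i <- r | P i) G i).
Proof.
move=> FG; elim/big_rec2: _ => // i f g Pi fg.
exact: feqM (FG i Pi) fg.
Qed.

(** Each factor is replaced by its truncation after x^n, which makes the product
    a finite sum of monomials, one for every choice of exponents. *)
Lemma fcoef_prod (I : finType) (F : I -> fps R) n :
  fcoef (\prod_i F i) n =
  \sum_(h : {ffun I -> 'I_n.+1} | (\sum_i h i)%N == n) \prod_i fcoef (F i) (h i).
Proof.
pose G i : fps R := \sum_(j < n.+1) fpsC (fcoef (F i) j) * fpsX R ^+ j.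
have FG : feq n.+1 (\prod_i F i) (\prod_i G i).
  apply: feq_prod => i _ m mn; rewrite /G fcoef_sum.
  under eq_bigr => j _ do rewrite fcoefCM -[fpsX R ^+ j]mulr1 fcoefXnM fcoef1.
  rewrite (bigD1 (Ordinal mn)) //= leqnn subnn mulr1 big1 ?addr0 // => j.
  rewrite -val_eqE /= => jm; case: leqP => jm'; rewrite ?mulr0 //.
  by rewrite subn_eq0 leqNgt ltn_neqAle jm jm' mulr0.
rewrite FG // bigA_distr_bigA /= fcoef_sum [RHS]big_mkcond /=.
apply: eq_bigr => h _; rewrite big_split.
have -> : \prod_i fpsC (fcoef (F i) (h i)) = fpsC (\prod_i fcoef (F i) (h i)).
  by rewrite rmorph_prod.
have -> : \prod_i fpsX R ^+ h i = fpsX R ^+ (\sum_i h i).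
  by rewrite expr_sum.
rewrite fcoefCM -[fpsX R ^+ _]mulr1 fcoefXnM fcoef1 subn_eq0.
have [eqn|nn] := eqVneq (\sum_i h i)%N n; first by rewrite eqn leqnn mulr1.
by case: leqP => hn; rewrite ?mulr0 // leqNgt ltn_neqAle nn hn mulr0.
Qed.

(** The derivation x d/dx.  Unlike d/dx it does not shift the coefficients, so
    that logarithmic derivatives can be compared degree by degree. *)
Definition euler f : fps R := Fps (fun n => fcoef f n *+ n).

Lemma fcoef_euler f n : fcoef (euler f) n = fcoef f n *+ n.
Proof. by []. Qed.

Lemma eulerD f g : euler (f + g) = euler f + euler g.
Proof. by apply: fpsP => n /=; rewrite mulrnDl. Qed.

Lemma eulerN f : euler (- f) = - euler f.
Proof. by apply: fpsP => n /=; rewrite mulNrn. Qed.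

Lemma eulerM f g : euler (f * g) = euler f * g + f * euler g.
Proof.
apply: fpsP => n; rewrite fcoefD !fcoefM fcoef_euler fcoefM -big_split -sumrMnl.
apply: eq_bigr => j _ /=; rewrite mulrnAl mulrnAr -mulrnDr subnKC //.
exact: leq_ord.
Qed.

Lemma eulerC c : euler (fpsC c) = 0.
Proof. by apply: fpsP => -[|n] //=; rewrite mul0rn. Qed.

Lemma euler0 : euler 0 = 0.
Proof. by apply: fpsP => n /=; rewrite mul0rn. Qed.

Lemma euler1 : euler 1 = 0.
Proof. exact: eulerC. Qed.

Lemma eulerCM c f : euler (fpsC c * f) = fpsC c * euler f.
Proof. by rewrite eulerM eulerC mul0r add0r. Qed.

Lemma euler_sum (I : Type) (r : seq I) (P : pred I) (F : I -> fps R) :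
  euler (\sum_(i <- r | P i) F i) = \sum_(i <- r | P i) euler (F i).
Proof. exact: (big_morph euler eulerD euler0). Qed.

Lemma eulerXn f n : euler (f ^+ n.+1) = euler f * f ^+ n *+ n.+1.
Proof.
elim: n => [|n IHn]; first by rewrite expr1 expr0 mulr1.
rewrite exprS eulerM IHn mulrnAr mulrCA -exprS.
by rewrite -mulrS.
Qed.

Lemma eulerX : euler (fpsX R) = fpsX R.
Proof. by apply: fpsP => -[|[|n]] //=; rewrite ?mulr0n ?mul0rn. Qed.

Lemma eulerXk k : euler (fpsX R ^+ k) = fpsX R ^+ k *+ k.
Proof. by case: k => [|k]; rewrite ?euler1 // eulerXn eulerX -exprS. Qed.

Lemma euler_prod (I : Type) (r : seq I) (P : pred I) (F L : I -> fps R) :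
  (forall i, P i -> euler (F i) = L i * F i) ->
  euler (\prod_(i <- r | P i) F i) =
  (\sum_(i <- r | P i) L i) * \prod_(i <- r | P i) F i.
Proof.
move=> FL; elim/big_rec2: _ => [|i f g Pi fg].
  by rewrite euler1 mul0r.
by rewrite eulerM fg FL // mulrDl -!mulrA; congr (_ + _); rewrite mulrCA.
Qed.

Lemma euler_inv f : f \is a GRing.unit -> euler f^-1 = - (euler f / f) * f^-1.
Proof.
move=> uf; apply: (mulrI uf); apply: (addrI (euler f * f^-1)).
by rewrite -eulerM mulrV // euler1 mulrCA mulrV // mulr1 subrr.
Qed.

Lemma fcoefV0 f : fcoef f 0 = 1 -> fcoef f^-1 0 = 1.
Proof.
move=> f0; have /(congr1 (fun g => fcoef g 0)) := mulVr (fps_unit0 f0).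
by rewrite fcoefM0 f0 mulr1.
Qed.

Definition torsion_free := forall n (a : R), a *+ n.+1 = 0 -> a = 0.

(** With f' = L f in terms of x d/dx, the coefficient n f_n involves only lower
    coefficients of f, because L has no constant term.  The hypotheses are
    stated modulo x^N since the finite necklace product used below has the right
    logarithmic derivative only up to a given degree. *)
Lemma euler_inj N f f' L L' : torsion_free ->
  feq N L L' -> fcoef L 0 = 0 -> euler f = L * f -> euler f' = L' * f' ->
  fcoef f 0 = fcoef f' 0 -> feq N f f'.
Proof.
move=> tf LL L0 fL fL' f0 n; elim/ltn_ind: n => -[|n] IHn // nN.
apply/eqP; rewrite -subr_eq0; apply/eqP; apply: (@tf n).
rewrite mulrnBl -!fcoef_euler fL fL' !fcoefM -sumrB big1 // => -[[|j] jn] _ /=.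
  by rewrite -LL ?L0 ?mul0r ?subrr // (leq_ltn_trans _ nN).
have jn' : (j < n.+1)%N by rewrite -ltnS.
rewrite LL; last by apply: leq_ltn_trans nN.
rewrite IHn ?subrr // ?subSS ?ltnS ?leq_subr //.
by apply: leq_ltn_trans nN; rewrite (leq_trans (leq_subr _ _)).
Qed.

End FpsCoef.

Lemma fpsC_unit (R : comUnitRingType) (c : R) :
  c \is a GRing.unit -> fpsC c \is a GRing.unit.
Proof.
by move=> uc; apply/fps_unit_const; exists c^-1; rewrite /= mulVr.
Qed.

(** * Limits, exponentials and logarithms *)

(** R carries no inverse operation, so the inverses are asserted to exist. *)
Definition nat_invertible (R : comNzRingType) :=
  forall n, exists c : R, c * n.+1%:R = 1.

Section SeriesLimits.
Variable R : comNzRingType.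
Hypothesis natR : nat_invertible R.
Implicit Types f g : fps (fps R).

Lemma fps_limP (u : nat -> fps (fps R)) l :
  (forall N, feq N (u N) l) -> fps_lim u = l.
Proof.
move=> ul; apply: fps_cvg_lim => n m; exists n.+1 => N nN.
by rewrite (ul N).
Qed.

(** The coefficient of x^n no longer changes after step n + 1. *)
Lemma fps_lim_cauchy (u : nat -> fps (fps R)) :
  (forall N, feq N (u N.+1) (u N)) -> forall N, feq N (u N) (fps_lim u).
Proof.
move=> cu; have cuN k n N : (n < N)%N -> fcoef (u (k + N)%N) n = fcoef (u N) n.
  move=> nN; elim: k => // k IHk; rewrite addSn cu //.
  by rewrite (leq_trans nN) ?leq_addl.
pose l : fps (fps R) := Fps (fun n => fcoef (u n.+1) n).
have ul N : feq N (u N) l.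
  by move=> n nN; rewrite -(subnK nN) cuN.
by rewrite (fps_limP ul).
Qed.

Lemma fps_series_feq a F : (forall i, (a <= i)%N -> feq i (F i) 0) ->
  forall N, feq N (\sum_(a <= i < N) F i) (\sum_(a <= i <oo) F i : fps (fps R)).
Proof.
move=> F0; apply: fps_lim_cauchy => N n nN.
have [aN|aN] := leqP a N; last by rewrite !big_geq // ltnW.
by rewrite big_nat_recr //= F0 // addr0.
Qed.

Lemma fps_infprod_feq a F : (forall i, (a <= i)%N -> feq i (F i) 1) ->
  forall N, feq N (\prod_(a <= i < N) F i) (\prod_(a <= i <oo) F i : fps (fps R)).
Proof.
move=> F1; apply: fps_lim_cauchy => N.
have [aN|aN] := leqP a N; last by rewrite !big_geq // ltnW.
rewrite big_nat_recr //= => n nN.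
by rewrite -[in RHS](mulr1 (\prod_(_ <= _ < _) _)); apply: (feqM (N := N)) => //; apply: F1.
Qed.

Lemma nat_invertible_fps : nat_invertible (fps R).
Proof.
move=> n; have [c cn] := natR n; exists (fpsC c).
by rewrite -(rmorph_nat (@fpsC R)) -rmorphM cn rmorph1.
Qed.

Lemma nat_unit (S : comUnitRingType) n : nat_invertible S -> (0 < n)%N ->
  n%:R \is a @GRing.unit S.
Proof.
case: n => // n /(_ n)[c cn] _; apply/unitrPr; exists c.
by rewrite mulrC.
Qed.

Lemma nat_invertible_torsion_free : torsion_free R.
Proof.
move=> n a an; have [c cn] := natR n.
by rewrite -[a]mul1r -cn -mulrA mulr_natl an mulr0.
Qed.

End SeriesLimits.

Section ExpLogDerivatives.
Variable R : comNzRingType.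
Hypothesis natR : nat_invertible R.
Implicit Types f g : fps (fps R).

Let natU n : (0 < n)%N -> n%:R \is a @GRing.unit (fps (fps R)).
Proof. exact/nat_unit/nat_invertible_fps/nat_invertible_fps. Qed.

Lemma euler_natV n : euler (n%:R^-1 : fps (fps R)) = 0.
Proof.
case: n => [|n]; first by rewrite invr0 euler0.
rewrite euler_inv ?natU // -(rmorph_nat (@fpsC (fps R))) eulerC.
by rewrite mul0r oppr0 mul0r.
Qed.

Lemma feq_exprn0 f N m : fcoef f 0 = 0 -> (N <= m)%N -> feq N (f ^+ m) 0.
Proof. by move=> f0 Nm n nN; rewrite fcoef_expr0 // (leq_trans nN). Qed.

Lemma feq_mul0 f g N : feq N f 0 -> feq N (f * g) 0.
Proof. by move=> f0; rewrite -[X in feq _ _ X](mul0r g); apply: feqM. Qed.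

Lemma fps_exp_feq f N : fcoef f 0 = 0 ->
  feq N (\sum_(0 <= m < N) (f ^+ m / m`!%:R)) (fps_exp f).
Proof.
move=> f0; apply: fps_series_feq => i _.
by apply: feq_mul0; apply: feq_exprn0.
Qed.

Lemma fps_exp0 f : fcoef f 0 = 0 -> fcoef (fps_exp f) 0 = 1.
Proof.
move=> f0; rewrite -(@fps_exp_feq f 1) // big_nat1 expr0 fact0 invr1 mulr1.
by rewrite fcoef1.
Qed.

(** The Euler derivative of a partial sum of the exponential series is the
    derivative of f times the previous partial sum. *)
Lemma euler_exp f : fcoef f 0 = 0 -> euler (fps_exp f) = euler f * fps_exp f.
Proof.
move=> f0; apply: fpsP => n.
rewrite fcoef_euler -(@fps_exp_feq f n.+2) // -fcoef_euler.
have -> : euler (\sum_(0 <= m < n.+2) (f ^+ m / m`!%:R)) =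
    euler f * \sum_(0 <= m < n.+1) (f ^+ m / m`!%:R).
  rewrite euler_sum big_nat_recl // expr0 eulerM euler1 mul0r add0r.
  rewrite euler_natV mulr0 add0r mulr_sumr; apply: eq_bigr => m _.
  rewrite eulerM euler_natV mulr0 addr0 eulerXn -mulr_natr -!mulrA.
  congr (_ * (_ * _)); rewrite factS natrM invrM ?natU ?fact_gt0 //.
  by rewrite mulrCA divrr ?natU // mulr1.
by apply: (@feqM _ n.+1) => // j jn; rewrite fps_exp_feq.
Qed.

Lemma fps_log_feq g N : fcoef g 0 = 1 ->
  feq N (\sum_(1 <= m < N) ((-1) ^+ m.+1 * (g - 1) ^+ m / m%:R)) (fps_log g).
Proof.
move=> g0; apply: fps_series_feq => i _.
rewrite -mulrA mulrC; apply: feq_mul0; apply: feq_mul0; apply: feq_exprn0 => //.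
by rewrite fcoefD g0 fcoefN fcoef1 subrr.
Qed.

Lemma fps_log0 g : fcoef g 0 = 1 -> fcoef (fps_log g) 0 = 0.
Proof.
by move=> g0; rewrite -(@fps_log_feq g 1) // big_geq.
Qed.

Lemma euler_sign m : euler ((-1) ^+ m : fps (fps R)) = 0.
Proof.
have -> : (-1) ^+ m = fpsC ((-1) ^+ m) :> fps (fps R).
  by rewrite rmorphXn rmorphN1.
exact: eulerC.
Qed.

(** The sign and the inverse of m + 1 are constants for x d/dx. *)
Lemma euler_log_term g m :
  euler ((-1) ^+ m.+2 * (g - 1) ^+ m.+1 / m.+1%:R) = euler g * (1 - g) ^+ m.
Proof.
have := euler_natV m.+1; have := divrr (natU (ltn0Sn m)).
move: (m.+1%:R^-1) => v v1 v0.
have s0 := euler_sign m.+2.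
have sE : (-1) ^+ m.+2 = (-1) ^+ m :> fps (fps R).
  by rewrite !exprS !mulN1r opprK.
move: ((-1) ^+ m.+2) s0 sE => e s0 sE.
rewrite !eulerM v0 s0 mulr0 addr0 mul0r add0r eulerXn eulerD eulerN euler1.
rewrite oppr0 addr0 -mulr_natr -!mulrA v1 mulr1 -(opprB g 1) [in RHS]exprNn sE.
exact: mulrCA.
Qed.

(** The derivatives of the terms form a geometric series in 1 - g, whose
    partial sums are inverses of g modulo powers of x. *)
Lemma euler_log g : fcoef g 0 = 1 -> euler (fps_log g) = euler g / g.
Proof.
move=> g0; apply: (mulrI (fps_unit0 g0)).
rewrite mulrCA mulrV ?fps_unit0 // mulr1; apply: fpsP => n.
have -> : fcoef (g * euler (fps_log g)) n =
  fcoef (g * euler (\sum_(1 <= m < n.+2) ((-1) ^+ m.+1 * (g - 1) ^+ m / m%:R))) n.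
  apply: (@feqM _ n.+1) => // j jn; rewrite !fcoef_euler (@fps_log_feq g n.+2) //.
  exact: ltnW.
have -> : euler (\sum_(1 <= m < n.+2) ((-1) ^+ m.+1 * (g - 1) ^+ m / m%:R)) =
    euler g * \sum_(m < n.+1) (1 - g) ^+ m.
  rewrite euler_sum big_add1 big_mkord mulr_sumr; apply: eq_bigr => m _.
  exact: euler_log_term.
rewrite mulrCA -[X in X * \sum_(m < _) _](subKr 1) -opprB mulNr -subrX1.
rewrite opprB mulrBr mulr1 fcoefD fcoefN mulrC.
rewrite (@feq_mul0 ((1 - g) ^+ n.+1) (euler g) n.+1) ?subr0 //.
by apply: feq_exprn0 => //; rewrite fcoefD fcoefN g0 fcoef1 subrr.
Qed.

(** In degree n only the factors up to index n contribute, both to the product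
    and to the sum of the logarithmic derivatives. *)
Lemma fps_infprod_euler (F L : nat -> fps (fps R)) :
  (forall i, (1 <= i)%N -> feq i (F i) 1) ->
  (forall i, (1 <= i)%N -> feq i (L i) 0) ->
  (forall i, (1 <= i)%N -> euler (F i) = L i * F i) ->
  euler (\prod_(1 <= i <oo) F i) =
    Fps (fun n => fcoef (\sum_(1 <= i < n.+1) L i) n) * \prod_(1 <= i <oo) F i.
Proof.
move=> F1 L0 FL; apply: fpsP => n.
rewrite fcoef_euler -(fps_infprod_feq F1 (ltnSn n)) -fcoef_euler.
rewrite big_nat_cond (@euler_prod _ _ _ _ _ L); last first.
  by move=> i /andP[/andP[i1 _] _]; apply: FL.
rewrite -!big_nat_cond.
apply: (@feqM _ n.+1) => //; last exact: fps_infprod_feq.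
move=> j jn; rewrite !fcoef_sum /=; rewrite fcoef_sum.
rewrite (@big_cat_nat _ _ _ j.+1) //= [X in _ + X]big_nat_cond.
rewrite [X in _ + X]big1 ?addr0 // => i /andP[/andP[ji _] _].
by apply: L0 => //; apply: leq_ltn_trans ji.
Qed.

End ExpLogDerivatives.

(** * Transfer from letter to letter *)

(** The letters v and w may stand next to each other, in this order, d telling
    whether the permutation has a descent between the two places. *)
Definition marked_le (d : bool) (v w : nat) : bool :=
  (v < w)%N || (v == w) && (odd v == d).

Section Transfer.
Variables (R : comNzRingType) (y : R).
Local Notation t := (fpsX R).
Local Notation c := (fpsC y).
Local Notation g := (1 - fpsX R)^-1.
Implicit Types (V : nat -> R) (s f : fps R).

Definition parity_wt (v : nat) : R := if odd v then y else 1.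

(** [V v] is the weighted number of words ending in v; one more letter is
    appended. *)
Definition letter_step V (d : bool) (w : nat) : R :=
  parity_wt w * \sum_(v < w.+1 | marked_le d v w) V v.

Lemma letter_stepE V d w :
  letter_step V d w = parity_wt w * (\sum_(v < w) V v + (if odd w == d then V w else 0)).
Proof.
rewrite /letter_step big_mkcond big_ord_recr /= /marked_le ltnn eqxx /=.
congr (_ * (_ + _)); apply: eq_bigr => v _.
by rewrite ltn_ord.
Qed.

Lemma geom_unit : 1 - t \is a GRing.unit.
Proof. by apply: fps_unit0; rewrite fcoefD fcoef1 fcoefN subr0. Qed.

(** Division by 1 - t takes partial sums. *)
Lemma fcoef_geom (u : nat -> R) f : u 0 = fcoef f 0 ->
  (forall b, u b.+1 = u b + fcoef f b.+1) -> forall b, fcoef (f * g) b = u b.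
Proof.
move=> u0 uS b; suff -> : f * g = Fps u by [].
apply: (mulIr geom_unit); rewrite -mulrA mulVr ?geom_unit // mulr1.
apply: fpsP => -[|n]; rewrite mulrBr mulr1 fcoefD fcoefN mulrC fcoefXM /=.
  by rewrite subr0.
by rewrite uS addrC addKr.
Qed.

(** [prev] tells whether the last comparison was a descent.  The numbers of
    words ending in an even letter 2a and in the odd letter next to it are
    governed by a single series s: after an ascent (or at the start) the odd
    neighbour is 2a + 1, after a descent it is 2a - 1.  In the second case a
    word cannot end in the smallest letter, whence the condition on s. *)
Definition letter_state (prev : bool) V s : Prop :=
  (prev -> fcoef s 0 = 0) /\
  forall a, V a.*2 = fcoef s a /\
            V a.*2.+1 = y * fcoef s (if prev then a.+1 else a).

(** The four transition factors; the missing denominator 1 - t is common. *)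
Definition step_factor (prev d : bool) : fps R :=
  if prev then (if d then c + t else 1 + c)
  else (if d then t * (1 + c) else 1 + c * t).

Lemma sum_double V b :
  \sum_(v < b.+1.*2) V v = \sum_(v < b.*2) V v + V b.*2 + V b.*2.+1.
Proof. by rewrite doubleS !big_ord_recr. Qed.

(** This is also the sum over a whole alphabet 0, ..., 2b, so the end of the
    word behaves like one further ascent. *)
Lemma letter_state_total prev V s : letter_state prev V s -> forall b,
  \sum_(v < b.*2.+1) V v = fcoef (s * (step_factor prev false * g)) b.
Proof.
case=> s0 sV b; rewrite mulrA; apply/esym.
apply: (fcoef_geom (u := fun b => \sum_(v < b.*2.+1) V v)) => {b}.
  rewrite big_ord1; have [-> _] := sV 0%N.
  case: prev s0 {sV} => s0; rewrite /step_factor mulrDr mulr1 fcoefD.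
    by rewrite (mulrC s) fcoefCM s0 // mulr0 addr0.
  by rewrite mulrCA fcoefCM (mulrC s) fcoefXM mulr0 addr0.
move=> b; set h := fcoef _ b.+1.
rewrite doubleS big_ord_recr big_ord_recr /= -addrA {}/h; congr (_ + _).
have [_ ->] := sV b; have := sV b.+1; rewrite doubleS => -[-> _].
case: prev {s0 sV}; rewrite /step_factor mulrDr mulr1 fcoefD addrC; congr (_ + _).
  by rewrite (mulrC s) fcoefCM.
by rewrite mulrCA fcoefCM (mulrC s) fcoefXM.
Qed.

Lemma letter_state_partial prev V s : letter_state prev V s -> forall b,
  \sum_(v < b.*2) V v = fcoef (s * (step_factor prev true * g)) b.
Proof.
case=> s0 sV b; rewrite mulrA; apply/esym.
apply: (fcoef_geom (u := fun b => \sum_(v < b.*2) V v)) => {b}.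
  rewrite big_ord0; case: prev s0 {sV} => s0; rewrite /step_factor.
    by rewrite fcoefM0 s0 // mul0r.
  by rewrite mulrCA fcoefXM.
move=> b; rewrite sum_double -addrA; congr (_ + _).
have [-> ->] := sV b; case: prev {s0 sV}; rewrite /step_factor.
  by rewrite (mulrC s) mulrDl fcoefD fcoefXM fcoefCM addrC.
by rewrite mulrCA fcoefXM mulrDr mulr1 fcoefD (mulrC s) fcoefCM.
Qed.

(** A new even letter 2b after an ascent may equal the previous one, so all
    previous letters up to 2b are allowed; after a descent it may not, and
    only letters below 2b are.  For odd letters the roles are exchanged. *)
Lemma letter_state_step prev V s d : letter_state prev V s ->
  letter_state d (letter_step V d) (s * (step_factor prev d * g)).
Proof.
move=> sV; case: d.
  have := letter_state_partial sV; move: (s * _) => s' sE.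
  split=> [_|a]; first by rewrite -sE big_ord0.
  rewrite !letter_stepE /parity_wt /= odd_double /= addr0 mul1r sE; split=> //.
  by rewrite -sE sum_double big_ord_recr.
have := letter_state_total sV; move: (s * _) => s' sE.
split=> // a; rewrite !letter_stepE /parity_wt /= odd_double /= addr0 mul1r -sE.
by rewrite big_ord_recr.
Qed.

Lemma letter_state_init : letter_state false parity_wt g.
Proof.
split=> // a; rewrite /parity_wt /= odd_double /= -[g]mul1r.
rewrite (fcoef_geom (u := fun=> 1)) ?fcoef1 ?mulr1 // => b.
by rewrite fcoef1 addr0.
Qed.

Fixpoint walk_series (prev : bool) (ds : seq bool) : fps R :=
  if ds is d :: ds' then step_factor prev d * g * walk_series d ds'
  else step_factor prev false * g.

Lemma walk_seriesP prev V s ds : letter_state prev V s -> forall k,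
  \sum_(v < k.*2.+1) foldl letter_step V ds v = fcoef (s * walk_series prev ds) k.
Proof.
elim: ds prev V s => [|d ds IHds] prev V s sV k; first exact: letter_state_total.
by rewrite [LHS](IHds d _ _ (letter_state_step d sV)) -mulrA.
Qed.

(** Left peaks are the passages from ascent to descent; a word starts in the
    state of an ascent. *)
Fixpoint peaks (prev : bool) (ds : seq bool) : nat :=
  if ds is d :: ds' then ((~~ prev && d) + peaks d ds')%N else 0%N.

Hypothesis uy : exists y', y' * y = 1.

Lemma yDt_unit : c + t \is a GRing.unit.
Proof.
have [y' yy] := uy; apply/fps_unit_const; exists y'.
by rewrite fcoefD /= addr0.
Qed.

Lemma one_yt_unit : 1 + c * t \is a GRing.unit.
Proof. by apply: fps_unit0; rewrite fcoefD fcoefCM fcoef1 mulr0 addr0. Qed.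

(** The arguments substituted for the two statistics in (a), as series in t
    alone. *)
Definition lpk_arg : fps R := (1 + c) ^+ 2 * t / ((c + t) * (1 + c * t)).
Definition des_arg : fps R := (c + t) / (1 + c * t).

(** Every left peak is followed by a return to the ascending state, if only at
    the end of the word.  So a peak replaces two factors 1 + yt by t(1 + y) and
    1 + y, and every other descent replaces 1 + yt by y + t.  When the walk
    starts after a descent, one return has no matching peak; the last factor of
    the statement accounts for it. *)
Lemma walk_seriesE prev ds :
  walk_series prev ds = ((1 + c * t) * g) ^+ (size ds).+1
    * (lpk_arg ^+ peaks prev ds * des_arg ^+ count id ds)
    * (if prev then (1 + c) / (1 + c * t) else 1).
Proof.
have a1 : (1 + c * t) / (1 + c * t) = 1 by rewrite mulrV ?one_yt_unit.
have aK z : z = (1 + c * t) / (1 + c * t) * z by rewrite a1 mul1r.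
have b1 : (c + t) / (c + t) = 1 by rewrite mulrV ?yDt_unit.
(* A peak is also a descent, hence the product of both arguments. *)
have Y : lpk_arg * des_arg * (1 + c * t) = t * (1 + c) * ((1 + c) / (1 + c * t)).
  rewrite /lpk_arg /des_arg invrM ?yDt_unit ?one_yt_unit //.
  transitivity ((1 + c) ^+ 2 * t / (1 + c * t) * ((1 + c * t) / (1 + c * t))
    * ((c + t) / (c + t))); first by ring.
  by rewrite a1 b1; ring.
have T : des_arg * (1 + c * t) = c + t.
  by rewrite /des_arg mulrAC -mulrA a1 mulr1.
elim: ds prev => [|d ds IHds] prev /=.
  rewrite expr1 !expr0 !mulr1; case: prev => /=; last by rewrite mulr1.
  by rewrite [LHS]aK; ring.
rewrite IHds [in RHS]exprS.
set r := _ ^+ (size ds).+1; set p := lpk_arg ^+ peaks d ds.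
set q := des_arg ^+ count id ds; case: prev d @p => -[] p /=.
- by rewrite add0n add1n exprS -/p -/q -T; ring.
- by rewrite !add0n -/p -/q [LHS]aK; ring.
- rewrite !add1n !exprS -/p -/q.
  transitivity (t * (1 + c) * ((1 + c) / (1 + c * t)) * g * r * p * q).
    by ring.
  by rewrite -Y; ring.
- by rewrite !add0n -/p -/q; ring.
Qed.

End Transfer.

Section TupleSum.
Variables (R : comNzRingType) (y : R) (r : nat).

Lemma big_tuple_cons (T : finType) m (P : pred (m.+1.-tuple T))
    (F : m.+1.-tuple T -> R) :
  \sum_(s | P s) F s =
  \sum_(a : T) \sum_(s : m.-tuple T | P [tuple of a :: s]) F [tuple of a :: s].
Proof.
rewrite pair_big_dep /=.
rewrite (reindex (fun p : T * m.-tuple T => [tuple of p.1 :: p.2])) //=.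
exists (fun s : m.+1.-tuple T => (thead s, [tuple of behead s])) => [[a s] _|s _] /=.
  by congr pair; apply: val_inj.
by rewrite [in RHS](tuple_eta s).
Qed.

Fixpoint marked_path (ds : seq bool) (v : nat) (s : seq nat) : bool :=
  if (ds, s) is (d :: ds', w :: s') then
    marked_le d v w && marked_path ds' w s'
  else true.

(** Appending letters one at a time, V being the weights of the first letter. *)
Lemma sum_marked_path (ds : seq bool) (V : nat -> R) :
  \sum_(v < r) \sum_(s : (size ds).-tuple 'I_r
                    | marked_path ds v [seq val i | i <- s])
     V v * \prod_(i <- s) parity_wt y i
  = \sum_(v < r) foldl (letter_step y) V ds v.
Proof.
elim: ds V => [|d ds IHds] V /=.
  apply: eq_bigr => v _; rewrite (big_pred1 [tuple]); last first.
    by move=> s; rewrite (tuple0 s); apply/esym/eqP.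
  by rewrite big_nil mulr1.
rewrite -IHds; under eq_bigr => v _ do rewrite big_tuple_cons.
rewrite exchange_big /=; apply: eq_bigr => w _.
under eq_bigr => v _.
  rewrite big_mkcond /=.
  under eq_bigr => s _ do rewrite big_cons.
  over.
rewrite exchange_big /= [RHS]big_mkcond /=; apply: eq_bigr => s _.
case: (marked_path ds w _); last first.
  by rewrite big1 // => v _; rewrite andbF.
rewrite /letter_step (@big_ord_widen_cond _ _ _ w.+1 r (fun v => marked_le d v w)) //.
rewrite mulrAC mulr_sumr [RHS]big_mkcond; apply: eq_bigr => v _.
rewrite andbT ltnS; case: (boolP (marked_le d v w)) => [vw|] //=.
rewrite mulrC; by have -> : (v <= w)%N by case/orP: vw => [/ltnW|/andP[/eqP->]].
Qed.

End TupleSum.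

(** * Words compatible with a given permutation *)

Lemma marked_pathP ds (v : nat) s : size s = size ds ->
  reflect (forall i, (i < size ds)%N ->
             marked_le (nth false ds i) (nth 0%N (v :: s) i) (nth 0%N s i))
          (marked_path ds v s).
Proof.
elim: ds v s => [|d ds IHds] v [|w s] //= sz; first by apply: ReflectT.
case: sz => sz.
apply: (iffP andP) => [[vw /(IHds _ _ sz) IH] [|i] //|H].
  by rewrite ltnS => /IH.
by split; [apply: (H 0%N)|apply/(IHds _ _ sz) => i id; apply: (H i.+1)].
Qed.

Section Compatible.
Variables (n : nat) (r : nat).
Implicit Types (p : 'S_n) (f : 'I_n -> 'I_r).

Definition compat_rel p (f : 'I_n -> 'I_r) (i j : 'I_n) : bool :=
  (f i < f j)%N || (f i == f j) && (odd (f i) == (p j < p i)%N).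

Definition compatible p (f : 'I_n -> 'I_r) : bool :=
  [forall i : 'I_n, forall j : 'I_n, (i < j)%N ==> compat_rel p f i j].

Lemma compatibleP p f :
  reflect (forall i j : 'I_n, (i < j)%N -> compat_rel p f i j) (compatible p f).
Proof.
apply: (iffP forallP) => [H i j|H i]; first exact/implyP/(forallP (H i)).
by apply/forallP => j; apply/implyP/H.
Qed.

Lemma compat_rel_trans p f : transitive (compat_rel p f).
Proof.
move=> j i k; rewrite /compat_rel -!val_eqE /=.
case: (ltngtP (f i) (f j)) => //= [ij|ij].
  by move=> _ /orP[/(ltn_trans ij) -> //|/andP[/eqP <-]]; rewrite ij.
rewrite ij => Hij /orP[->//|/andP[-> Hjk]]; rewrite /= orbC.
move: Hij Hjk; case: (odd (f j)).
  by move/eqP/esym=> ij' /eqP/esym/ltn_trans ->.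
rewrite ![false == _]eq_sym !eqbF_neg -!leqNgt => ij' jk'.
by rewrite (leq_trans ij' jk').
Qed.

End Compatible.

Lemma letterE n (p : 'S_n) (i : 'I_n) : letter p i.+1 = (p i).+1.
Proof.
rewrite /letter /= (nth_map i); last by rewrite size_enum_ord.
by rewrite nth_ord_enum.
Qed.

Definition descents n (p : 'S_n) : seq bool :=
  [seq descent p i | i <- index_iota 1 n].

Lemma desE n (p : 'S_n) : des p = count id (descents p).
Proof. by rewrite /descents count_map. Qed.

Lemma peaks_count (D : nat -> bool) prev a m :
  peaks prev [seq D i | i <- iota a m] =
  count (fun i => D i && ~~ (if i == a then prev else D i.-1)) (iota a m).
Proof.
elim: m prev a => //= m IHm prev a; rewrite eqxx IHm andbC; congr (_ + _)%N.
apply: eq_in_count => i; rewrite mem_iota => /andP[ai _].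
by rewrite (gtn_eqF ai); case: eqP => // ->.
Qed.

Lemma lpkE n (p : 'S_n) : lpk p = peaks false (descents p).
Proof.
rewrite /descents /index_iota peaks_count; apply: eq_in_count => i.
rewrite mem_iota /left_peak => /andP[i1 iN].
have {iN} iN : (i < n)%N by lia.
case: i i1 iN => [//|[|i]] _ iN /=; first by rewrite andbT.
rewrite orbF andbC; congr andb; rewrite /descent -leqNgt [RHS]leq_eqVlt.
have i0 : (i < n)%N by lia.
have i1 : (i.+1 < n)%N by lia.
rewrite (letterE p (Ordinal i0)) (letterE p (Ordinal i1)) eqSS val_eqE.
by rewrite (inj_eq perm_inj) -val_eqE /= ltn_eqF.
Qed.

(** By transitivity only neighbours matter, and for neighbours the condition on
    p says whether there is a descent. *)
Lemma compatible_tuple n r (p : 'S_n.+1) (s : n.+1.-tuple 'I_r) :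
  compatible p (fun i => tnth s i) =
  marked_path (descents p) (thead s) [seq val i | i <- behead s].
Proof.
set f := fun i => tnth s i.
have sz : size [seq val i | i <- behead s] = size (descents p).
  by rewrite !size_map size_iota size_behead size_tuple subn1.
have fE i (ltin : (i < n.+1)%N) : nth 0%N [seq val i | i <- s] i = f (Ordinal ltin).
  rewrite (nth_map (thead s)) ?size_tuple // /f.
  by rewrite (tnth_nth (thead s)).
have szd : size (descents p) = n by rewrite size_map size_iota subn1.
have sE : [seq val i | i <- s] = val (thead s) :: [seq val i | i <- behead s].
  by rewrite [in LHS](tuple_eta s).
have neighborE i (ltin : (i < n.+1)%N) (ltiSn : (i.+1 < n.+1)%N) :
    compat_rel p f (Ordinal ltin) (Ordinal ltiSn) =
    marked_le (nth false (descents p) i) (f (Ordinal ltin)) (f (Ordinal ltiSn)).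
  rewrite (nth_map 0%N); last by rewrite size_iota subn1.
  rewrite nth_iota; last by rewrite subn1.
  by rewrite /descent (letterE p (Ordinal ltin)) (letterE p (Ordinal ltiSn)).
have nthE i ltin : nth ord0 (enum 'I_n.+1) i = Ordinal (ltin : (i < n.+1)%N).
  by apply: val_inj; rewrite /= nth_enum_ord.
transitivity (sorted (compat_rel p f) (enum 'I_n.+1)).
  rewrite sorted_pairwise; last exact: compat_rel_trans.
  apply/compatibleP/(pairwiseP ord0) => [H i j|H i j ij].
    rewrite !inE size_enum_ord => ltin ltjn ij.
    by rewrite !nthE; apply: H.
  have := H i j; rewrite !inE !size_enum_ord !nth_ord_enum; exact.
apply/(sortedP ord0)/(marked_pathP _ sz) => H i.
  rewrite szd => iN; have := H i; rewrite size_enum_ord ltnS => /(_ iN).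
  rewrite !nthE; first by apply: leq_trans iN _.
  move=> i1; rewrite neighborE -!fE sE; exact.
rewrite size_enum_ord => iN; have := H i; rewrite szd => /(_ iN).
rewrite !nthE; first by apply: ltnW.
move=> i1; rewrite neighborE -!fE sE; exact.
Qed.

Section Ppartition.
Variables (R : comNzRingType) (y : R).
Hypothesis uy : exists y', y' * y = 1.

(** The left-hand side of (a) for a single permutation. *)
Lemma sum_compatible n (p : 'S_n.+1) k :
  \sum_(f : {ffun 'I_n.+1 -> 'I_k.*2.+1} | compatible p f) \prod_i parity_wt y (f i)
  = fcoef ((1 + fpsC y * fpsX R) ^+ n.+1 / (1 - fpsX R) ^+ n.+2
      * (lpk_arg y ^+ lpk p * des_arg y ^+ des p)) k.
Proof.
have szd : size (descents p) = n by rewrite size_map size_iota subn1.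
have := walk_seriesP (descents p) (letter_state_init y) k; rewrite (walk_seriesE uy) szd mulr1.
rewrite -lpkE -desE exprMn.
set q := lpk_arg y ^+ _ * _ => wE.
transitivity (fcoef ((1 - fpsX R)^-1 * ((1 + fpsC y * fpsX R) ^+ n.+1
    * (1 - fpsX R)^-1 ^+ n.+1 * q)) k); last first.
  by congr fcoef; rewrite -exprVn [_^-1 ^+ n.+2]exprS; ring.
rewrite -wE -sum_marked_path szd.
rewrite (reindex (fun s : n.+1.-tuple 'I_k.*2.+1 => [ffun i => tnth s i])) /=; last first.
  exists (fun f => [tuple f i | i < n.+1]) => [s _|f _].
    by apply: eq_from_tnth => i; rewrite tnth_mktuple ffunE.
  by apply/ffunP => i; rewrite ffunE tnth_mktuple.
have compE (s : n.+1.-tuple 'I_k.*2.+1) :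
    compatible p [ffun i => tnth s i] = compatible p (fun i => tnth s i).
  by apply: eq_forallb => i; apply: eq_forallb => j; rewrite /compat_rel !ffunE.
under eq_bigl => s do rewrite compE compatible_tuple.
rewrite big_tuple_cons; apply: eq_bigr => v _; apply: eq_big => [s|s _] /=.
  by rewrite theadE.
transitivity (\prod_(i <- [tuple of v :: s]) parity_wt y i); last by rewrite big_cons.
by rewrite big_tuple; apply: eq_bigr => i _; rewrite ffunE.
Qed.
End Ppartition.

Local Open Scope nat_scope.

(** * Itineraries *)

Section Porbit.
Variables (T : finType) (s : {perm T}).

Lemma iter_porbit_fix m x : (iter m s x == x) = (#|porbit s x| %| m).
Proof.
set l := #|porbit s x|.
have l0 : 0 < l by rewrite lt0n card_porbit_neq0.
have iterM k : iter (k * l) s x = x.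
  by elim: k => // k IHk; rewrite mulSn iterD IHk iter_porbit.
rewrite [in LHS](divn_eq m l) addnC iterD iterM /dvdn.
have ml : m %% l < l by rewrite ltn_mod.
have := uniq_traject_porbit s x; rewrite -/l.
case: (m %% l) ml => [|j] jl; first by rewrite /= !eqxx.
move=> U; apply/negbTE/eqP => E.
have := nth_uniq x (i := 0) (j := j.+1) _ _ U; rewrite !size_traject.
by rewrite !nth_traject // E /= eqxx => /(_ l0 jl).
Qed.

Lemma sum_porbits (R : nmodType) (F : T -> R) :
  (\sum_x F x = \sum_(C in porbits s) \sum_(x in C) F x)%R.
Proof.
rewrite (partition_big (porbit s) (mem (porbits s))) /=; last first.
  by move=> x _; apply: imset_f.
apply: eq_bigr => C /imsetP[y _ ->]; apply: eq_bigl => x.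
by rewrite eq_porbit_mem.
Qed.

Lemma big_porbit (R : Type) (idx : R) (op : Monoid.com_law idx) (F : T -> R) x :
  \big[op/idx]_(y in porbit s x) F y =
  \big[op/idx]_(j < #|porbit s x|) F (iter j s x).
Proof.
rewrite (eq_bigl (mem (traject s x #|porbit s x|))); last exact: porbit_traject.
rewrite -big_uniq ?uniq_traject_porbit //= (big_nth x) size_traject big_mkord.
by apply: eq_bigr => j _; rewrite nth_traject.
Qed.

End Porbit.

(** Cycle lengths are at most n, so they divide n!.  For this reason n! serves
    as a common period of all itineraries. *)
Lemma iter_fact n (p : 'S_n) x : iter n`! p x = x.
Proof.
apply/eqP; rewrite iter_porbit_fix dvdn_fact // lt0n card_porbit_neq0 /=.
by rewrite -[n in _ <= n]card_ord max_card.
Qed.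

Section Words.
Variables (N r : nat).
Hypothesis N_gt0 : 0 < N.
Implicit Types s w : {ffun 'I_N -> 'I_r}.

(** A word of length N stands for the periodic sequence it generates; N is a
    common multiple of all periods of interest.  Primitive necklaces of length l
    dividing N are then the cycles of length l of the cyclic shift. *)
Definition shift_fun s : {ffun 'I_N -> 'I_r} := [ffun i => s (ordS i)].

Lemma shift_inj : injective shift_fun.
Proof.
move=> s w E; apply/ffunP => i; have /ffunP/(_ (ord_pred i)) := E.
by rewrite !ffunE ord_predK.
Qed.

Definition shift : {perm {ffun 'I_N -> 'I_r}} := perm shift_inj.

Definition letter_at s m : 'I_r := s (Ordinal (ltn_pmod m N_gt0)).

Lemma letter_at_shift s m : letter_at (shift s) m = letter_at s m.+1.
Proof.
rewrite /letter_at permE ffunE; congr (s _); apply: val_inj => /=.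
by rewrite -[in LHS]addn1 modnDml addn1.
Qed.

Lemma letter_at_iter j s m : letter_at (iter j shift s) m = letter_at s (m + j).
Proof.
by elim: j m => [|j IHj] m; rewrite ?addn0 //= letter_at_shift IHj addSnnS.
Qed.

Lemma letter_at_inj s w : (forall m, m < N -> letter_at s m = letter_at w m) -> s = w.
Proof.
move=> E; apply/ffunP => i; have := E i (ltn_ord i); rewrite /letter_at.
by have -> : Ordinal (ltn_pmod i N_gt0) = i by apply: val_inj; rewrite /= modn_small.
Qed.

(** The first m letters of the sequence read as a number in base r, the digits
    after an odd letter being complemented.  Comparing these numbers is the
    lexicographic order that is reversed after every odd letter. *)
Fixpoint lex_key m s : nat :=
  if m is m'.+1 then
    letter_at s 0 * r ^ m' +
    (if odd (letter_at s 0) then (r ^ m').-1 - lex_key m' (shift s)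
     else lex_key m' (shift s))
  else 0.

Lemma lex_key_lt m s : lex_key m s < r ^ m.
Proof.
elim: m s => // m IHm s /=; set a := letter_at s 0.
have r0 : 0 < r ^ m by rewrite expn_gt0; case: (r) (letter_at s 0) => [[]|].
have lt_a : a < r by [].
have IH := IHm (shift s).
rewrite expnS; apply: (@leq_trans (a.+1 * r ^ m)); last by rewrite leq_mul2r lt_a orbT.
rewrite mulSn [r ^ m + _]addnC ltn_add2l.
by case: odd => //; lia.
Qed.

Lemma lex_key_inj m s w : lex_key m s = lex_key m w ->
  forall j, j < m -> letter_at s j = letter_at w j.
Proof.
elim: m s w => // m IHm s w /=.
set F := fun x : {ffun _} =>
  if odd (letter_at x 0) then (r ^ m).-1 - lex_key m (shift x)
  else lex_key m (shift x).
have F_lt x : F x < r ^ m.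
  rewrite /F; have := lex_key_lt m (shift x); case: odd => //; lia.
rewrite -/(F s) -/(F w) => E.
have E0 : letter_at s 0 = letter_at w 0.
  apply: val_inj => /=; have := congr1 (divn^~ (r ^ m)) E.
  have r0 : 0 < r ^ m by apply: leq_ltn_trans (F_lt s).
  by rewrite !divnMDl // !divn_small // !addn0.
have {}E : F s = F w.
  by apply/eqP; rewrite -(eqn_add2l (letter_at s 0 * r ^ m)) E E0.
have {}E : lex_key m (shift s) = lex_key m (shift w).
  move: E; rewrite /F E0; have := lex_key_lt m (shift s); have := lex_key_lt m (shift w).
  case: odd => //; lia.
by case=> [|j] jm //; rewrite -!letter_at_shift; apply: IHm.
Qed.

Lemma lex_key_full_inj : injective (lex_key N).
Proof. by move=> s w E; apply: letter_at_inj; apply: lex_key_inj. Qed.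

End Words.

Section Itinerary.
Variables (n r : nat).
Implicit Types (p : 'S_n) (f : {ffun 'I_n -> 'I_r}).
Local Notation N := n`!.
Local Notation N0 := (fact_gt0 n).
Local Notation at_ := (letter_at N0).
Local Notation T := (shift N r).

Definition itinerary p f (x : 'I_n) : {ffun 'I_N -> 'I_r} :=
  [ffun i : 'I_N => f (iter i p x)].

Lemma letter_itinerary p f x m : at_ (itinerary p f x) m = f (iter m p x).
Proof.
rewrite /letter_at ffunE /=; congr (f _); rewrite [in RHS](divn_eq m N) addnC iterD.
by congr (iter _ _ _); elim: (m %/ N) => // k IHk; rewrite mulSn iterD -IHk iter_fact.
Qed.

Lemma itinerary_step p f x : T (itinerary p f x) = itinerary p f (p x).
Proof.
apply: (letter_at_inj (N_gt0 := N0)) => m _.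
by rewrite letter_at_shift !letter_itinerary iterSr.
Qed.

Lemma itinerary_iter p f x m :
  iter m T (itinerary p f x) = itinerary p f (iter m p x).
Proof. by elim: m => //= m ->; rewrite itinerary_step. Qed.

Lemma compatible_le p f (x y : 'I_n) : compatible p f -> x <= y -> f x <= f y.
Proof.
move=> /compatibleP pf; rewrite leq_eqVlt => /orP[/eqP/val_inj->//|/pf].
by case/orP => [/ltnW//|/andP[/eqP-> _]].
Qed.

Lemma compatible_block p f (x y : 'I_n) : compatible p f -> x != y -> f x = f y ->
  (p x < p y) = (if odd (f x) then y < x else x < y).
Proof.
move=> /compatibleP pf xy fxy.
have pxy : p x != p y by rewrite (inj_eq perm_inj).
move: xy pxy; rewrite -!val_eqE /= => xy pxy.
case: (ltngtP x y) xy => // [lt|lt] _; have := pf _ _ lt;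
  rewrite /compat_rel ?fxy ltnn eqxx /=; case: odd => /eqP/esym;
  by move: pxy; case: ltngtP.
Qed.

(** Points with the same first letter compare like their images under p, or in
    the opposite way, according to the parity of that letter; complementing the
    remaining digits compensates exactly for this. *)
Lemma lex_key_itinerary_le p f m (x y : 'I_n) : compatible p f -> x <= y ->
  lex_key N0 m (itinerary p f x) <= lex_key N0 m (itinerary p f y).
Proof.
move=> pf; elim: m x y => // m IHm x y; rewrite leq_eqVlt.
case/orP=> [/eqP/val_inj->//|xy] /=.
rewrite !letter_itinerary /= !itinerary_step.
have := compatible_le pf (ltnW xy); rewrite leq_eqVlt => /orP[/eqP/val_inj E|lt].
  rewrite E leq_add2l; have xy' : x != y by rewrite -val_eqE ltn_eqF.
  have := compatible_block pf xy' E; rewrite E; case: odd => E2.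
    by apply/leq_sub2l/IHm; rewrite leqNgt E2 -leqNgt ltnW.
  by apply/IHm/ltnW; rewrite E2.
set F := fun x =>
  if odd (f x) then (r ^ m).-1 - lex_key N0 m (itinerary p f (p x))
  else lex_key N0 m (itinerary p f (p x)).
have F_lt z : F z < r ^ m.
  rewrite /F; have := lex_key_lt N0 m (itinerary p f (p z)); case: odd => //; lia.
rewrite -/(F x) -/(F y); apply: (@leq_trans ((f x).+1 * r ^ m)).
  by rewrite mulSn addnC leq_add2r ltnW.
by apply: leq_trans (leq_addr _ _); rewrite leq_mul2r lt orbT.
Qed.

(** The rank of p x in the image of Q is the rank of x in Q, counted from
    below or from above. *)
Lemma monotone_uniq (Q : {set 'I_n}) p p' (e : bool) :
  p @: Q = p' @: Q ->
  {in Q &, forall x y : 'I_n, x != y -> (p x < p y) = (if e then y < x else x < y)} ->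
  {in Q &, forall x y : 'I_n, x != y -> (p' x < p' y) = (if e then y < x else x < y)} ->
  {in Q, p =1 p'}.
Proof.
move=> pQ mp mp' x xQ.
have rankE (q : 'S_n) :
   {in Q &, forall x y : 'I_n, x != y -> (q x < q y) = (if e then y < x else x < y)} ->
   #|[set z in q @: Q | z < q x]| = #|[set w in Q | (w != x) && (if e then x < w else w < x)]|.
  move=> mq; rewrite -(card_imset [set w in Q | _] (@perm_inj _ q)).
  apply: eq_card => z; rewrite !inE; apply/andP/imsetP => [[/imsetP[w wQ ->] lt]|].
    have wx : w != x by apply: contraTneq lt => ->; rewrite ltnn.
    by exists w => //; rewrite inE wQ wx -mq.
  case=> w; rewrite inE => /and3P[wQ wx lt] ->; split; first exact: imset_f.
  by rewrite mq.
have E : #|[set z in p @: Q | z < p x]| = #|[set z in p @: Q | z < p' x]|.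
  by rewrite rankE // [in RHS]pQ rankE.
have sub (a b : 'I_n) : a \in p @: Q -> a < b ->
    #|[set z in p @: Q | z < a]| < #|[set z in p @: Q | z < b]|.
  move=> aQ ab; apply: proper_card; apply/properP; split.
    by apply/subsetP => z; rewrite !inE => /andP[-> /ltn_trans ->].
  by exists a; rewrite !inE ?aQ ?ab ?ltnn.
case: (ltngtP (p x) (p' x)) => [lt|lt|/val_inj//].
  by have := sub _ _ (imset_f p xQ) lt; rewrite E ltnn.
have := sub _ _ _ lt; rewrite E ltnn => H; exfalso.
by have := H; rewrite pQ => /(_ (imset_f p' xQ)).
Qed.

Definition fiber p f s : {set 'I_n} := [set x | itinerary p f x == s].

Lemma fiber_step p f s : p @: fiber p f s = fiber p f (T s).
Proof.
apply/setP => z; apply/imsetP/idP => [[x]|].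
  by rewrite !inE => /eqP <- ->; rewrite itinerary_step.
rewrite inE => /eqP zE; exists (p^-1 z)%g; last by rewrite permKV.
rewrite inE; apply/eqP; apply: (@perm_inj _ T).
by rewrite itinerary_step permKV.
Qed.

(** The keys of the itineraries, listed along the points, form an increasing
    sequence; such a sequence is determined by its multiset of values. *)
Lemma itinerary_uniq p f p' f' : compatible p f -> compatible p' f' ->
  (forall s, #|fiber p f s| = #|fiber p' f' s|) -> itinerary p f =1 itinerary p' f'.
Proof.
move=> pf pf' E.
pose I q (g : {ffun 'I_n -> 'I_r}) :=
  [seq lex_key N0 N (itinerary q g x) | x <- enum 'I_n].
have IE : I p f = I p' f'.
  apply: (sorted_eq leq_trans anti_leq).
  - rewrite sorted_map; apply: (@sub_sorted _ (relpre val leq)).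
      by move=> x y; apply: lex_key_itinerary_le.
    by rewrite -sorted_map val_enum_ord iota_sorted.
  - rewrite sorted_map; apply: (@sub_sorted _ (relpre val leq)).
      by move=> x y; apply: lex_key_itinerary_le.
    by rewrite -sorted_map val_enum_ord iota_sorted.
  have Icomp q g : I q g = map (lex_key N0 N) (map (itinerary q g) (enum 'I_n)).
    by rewrite -map_comp.
  rewrite !Icomp; apply: perm_map.
  apply/allP => s _ /=.
  have cE q (g : {ffun 'I_n -> 'I_r}) :
    count_mem s [seq itinerary q g x | x <- enum 'I_n] = #|fiber q g s|.
    rewrite count_map -sum1_count big_enum_cond /= -sum1_card.
    by apply: eq_bigl => x; rewrite !inE.
  by rewrite !cE E.
move=> x; apply: (lex_key_full_inj (N_gt0 := N0)).
have := congr1 (fun s => nth 0 s x) IE.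
rewrite /I (nth_map x) ?size_enum_ord // [in RHS](nth_map x) ?size_enum_ord //.
by rewrite nth_ord_enum.
Qed.

(** Once the itineraries are known, p maps the points with itinerary s onto
    those with itinerary shifted by one, in a monotone way of prescribed
    direction. *)
Lemma compatible_uniq p f p' f' : compatible p f -> compatible p' f' ->
  (forall s, #|fiber p f s| = #|fiber p' f' s|) -> p = p' /\ f = f'.
Proof.
move=> pf pf' E; have IE := itinerary_uniq pf pf' E.
have fE : f = f'.
  apply/ffunP => x; have := letter_itinerary p f x 0; rewrite IE.
  by rewrite letter_itinerary.
split=> //; apply/permP => x; rewrite -{f'}fE in pf' E IE *.
set s := itinerary p f x.
have FE s' : fiber p f s' = fiber p' f s'.
  by apply/setP => z; rewrite !inE IE.
have fs z : z \in fiber p f s -> f z = f x.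
  rewrite inE => /eqP zs; rewrite -[f z](letter_itinerary p f z 0) zs.
  exact: letter_itinerary.
apply: (@monotone_uniq (fiber p f s) p p' (odd (f x))); last by rewrite inE.
- by rewrite fiber_step FE -fiber_step -FE.
- move=> a b aQ bQ ab; rewrite (compatible_block pf ab) ?fs //.
- move=> a b aQ bQ ab; rewrite (compatible_block pf' ab) ?fs //.
Qed.

End Itinerary.

(** * Cycle type of a compatible pair *)

Section NecklaceSets.
Variables (n r : nat).
Local Notation N := n`!.
Local Notation N0 := (fact_gt0 n).
Local Notation at_ := (letter_at N0).
Local Notation T := (shift N r).
Implicit Types (s : {ffun 'I_N -> 'I_r}) (C : {set {ffun 'I_N -> 'I_r}}).

Definition parity s m : bool := odd (\sum_(j < m) odd (at_ s j)).

Definition necklace_odd C : bool := odd (\sum_(s in C) odd (at_ s 0)).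

Lemma parityS s m : parity s m.+1 = parity s m (+) odd (at_ s m).
Proof. by rewrite /parity big_ord_recr /= oddD oddb. Qed.

Lemma parityD s l m : parity s (l + m) = parity s l (+) parity (iter l T s) m.
Proof.
rewrite /parity big_split_ord /= oddD; congr (_ (+) odd _).
by apply: eq_bigr => j _; rewrite letter_at_iter addnC.
Qed.

Lemma parity_necklace s C : C \in porbits T -> s \in C ->
  parity s #|C| = necklace_odd C.
Proof.
case/imsetP=> w _ ->; rewrite -eq_porbit_mem => /eqP <-.
rewrite /parity /necklace_odd (@big_porbit _ T _ _ _ (fun s => nat_of_bool (odd (at_ s 0)))).
by congr odd; apply: eq_bigr => j _; rewrite letter_at_iter add0n.
Qed.

End NecklaceSets.

(** An order reversing involution has at most one fixed point, and its other
    points come in pairs. *)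
Lemma card_fixed_reversal n (Q : {set 'I_n}) (q : 'S_n) :
  (forall x, x \in Q -> q x \in Q) ->
  (forall x, x \in Q -> q (q x) = x) ->
  (forall x y : 'I_n, x \in Q -> y \in Q -> x != y -> (q x < q y) = (y < x)) ->
  #|[set x in Q | q x == x]| = odd #|Q|.
Proof.
move=> qQ qq qlt.
pose F := [set x in Q | q x == x]; pose A := [set x in Q | x < q x].
pose B := [set x in Q | q x < x].
have F1 : #|F| <= 1.
  apply/card_le1_eqP => x y; rewrite !inE => /andP[xQ /eqP qx] /andP[yQ /eqP qy].
  apply/eqP/negPn/negP => xy; have := qlt y x yQ xQ xy; rewrite qx qy.
  by move: xy; rewrite -val_eqE /=; case: ltngtP.
have AB : #|B| = #|A|.
  rewrite -(card_imset A (@perm_inj _ q)); apply: eq_card => x.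
  apply/idP/imsetP => [|[y yA ->]].
    rewrite inE => /andP[xQ lt]; exists (q x); rewrite ?qq // inE qQ //=.
    by rewrite qq.
  by move: yA; rewrite !inE => /andP[yQ lt]; rewrite qQ // qq.
have cM : #|Q| = #|F| + (#|A| + #|B|).
  rewrite -(cardsID F Q); congr (_ + _).
    by apply: eq_card => x; rewrite !inE; case: (x \in Q).
  have AB0 : #|A :&: B| = 0.
    by apply/eq_card0 => x; rewrite !inE; case: ltngtP; rewrite ?andbF.
  rewrite -cardsUI AB0 addn0.
  apply: eq_card => x; rewrite !inE -val_eqE /=.
  by case: (x \in Q) => //=; case: ltngtP.
by rewrite -/F cM AB addnn oddD odd_double addbF; case: #|F| F1 => [|[]].
Qed.

(** The numbers of cycles of length l and 2l among the points whose itineraries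
    form a necklace of length l, when each itinerary occurs m times; [b] tells
    whether the necklace has an odd number of odd letters. *)
Definition short_cycles (b : bool) (m : nat) : nat := if b then nat_of_bool (odd m) else m.
Definition long_cycles (b : bool) (m : nat) : nat := if b then m./2 else 0.

Section CycleType.
Variables (n r : nat) (p : 'S_n) (f : {ffun 'I_n -> 'I_r}).
Local Notation N := n`!.
Local Notation N0 := (fact_gt0 n).
Local Notation at_ := (letter_at N0).
Local Notation T := (shift N r).
Local Notation It := (itinerary p f).
Implicit Types (s : {ffun 'I_N -> 'I_r}) (C : {set {ffun 'I_N -> 'I_r}}).

Lemma card_fiber_iter s m : #|fiber p f (iter m T s)| = #|fiber p f s|.
Proof.
elim: m => //= m IHm; rewrite -fiber_step card_imset //; exact: perm_inj.
Qed.

Definition occupancy C : nat := #|[set x | It x \in C]|.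

Lemma occupancyE s C : C \in porbits T -> s \in C -> occupancy C = #|C| * #|fiber p f s|.
Proof.
move=> /imsetP[w _ ->]; rewrite -eq_porbit_mem => /eqP <-.
rewrite /occupancy -sum1_card (partition_big It (mem (porbit T s))) /=; last first.
  by move=> x; rewrite inE.
rewrite (eq_bigr (fun=> #|fiber p f s|)); first by rewrite sum_nat_const.
move=> w' /porbitP[i ->]; rewrite permX -(card_fiber_iter s i) -sum1_card.
apply: eq_bigl => x; rewrite !inE andb_idl // => /eqP ->.
by rewrite -permX mem_porbit.
Qed.

Lemma sum_occupancy : \sum_(C in porbits T) occupancy C = n.
Proof.
rewrite -[RHS]card_ord -sum1_card (partition_big (fun x => porbit T (It x)) (mem (porbits T))) /=.
  apply: eq_bigr => C /imsetP[w _ ->]; rewrite /occupancy -sum1_card.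
  by apply: eq_bigl => x; rewrite inE eq_porbit_mem.
by move=> x _; apply: imset_f.
Qed.

Hypothesis pf : compatible p f.

(** Two points with the same itinerary see the same letters, and each odd letter
    reverses their order once. *)
Lemma fiber_iter_lt s m (x y : 'I_n) : x \in fiber p f s -> y \in fiber p f s ->
  x != y -> (iter m p x < iter m p y) = (if parity s m then y < x else x < y).
Proof.
elim: m x y => [|m IHm] x y xs ys xy; first by rewrite /parity big_ord0.
have pxy : iter m p x != iter m p y by rewrite -!permX (inj_eq perm_inj).
have fE z : z \in fiber p f s -> f (iter m p z) = at_ s m.
  by rewrite inE => /eqP <-; rewrite letter_itinerary.
rewrite !iterS (compatible_block pf pxy) ?fE // parityS.
rewrite !IHm //; last by rewrite eq_sym.
by case: (odd _); case: (parity _ _).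
Qed.

(** An order preserving permutation of a finite chain is the identity. *)
Lemma iter_fiber_id s m x : iter m T s = s -> parity s m = false ->
  x \in fiber p f s -> iter m p x = x.
Proof.
move=> sm ev xs; rewrite -permX.
have -> : (p ^+ m)%g x = (1 : 'S_n)%g x; last by rewrite perm1.
apply: (@monotone_uniq n (fiber p f s) _ _ false) => //; last 1 first.
- by move=> a b _ _ _; rewrite !perm1.
- have -> : (1%g : 'S_n) @: fiber p f s = fiber p f s.
    by rewrite -[RHS]imset_id; apply: eq_imset => z; rewrite perm1.
  apply/eqP; rewrite eqEcard card_imset ?leqnn ?andbT; last exact: perm_inj.
  apply/subsetP => _ /imsetP[z zs ->]; move: zs; rewrite !inE permX.
  by rewrite -itinerary_iter => /eqP ->; rewrite sm.
move=> a b aQ bQ ab; rewrite !permX (fiber_iter_lt m aQ bQ ab) ev //.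
Qed.

Section Fiber.
Variable s : {ffun 'I_N -> 'I_r}.
Let l := #|porbit T s|.
Let M := #|fiber p f s|.

Let l_gt0 : 0 < l. Proof. by rewrite lt0n card_porbit_neq0. Qed.
Let sl : iter l T s = s. Proof. exact: iter_porbit. Qed.

Lemma dvd_porbit_fiber x : x \in fiber p f s -> l %| #|porbit p x|.
Proof.
rewrite inE => /eqP xs; rewrite -iter_porbit_fix -xs itinerary_iter.
by rewrite iter_porbit.
Qed.

Lemma card_porbit_even x : parity s l = false -> x \in fiber p f s ->
  #|porbit p x| = l.
Proof.
move=> ev xs; apply/eqP; rewrite eqn_dvd dvd_porbit_fiber // andbT.
by rewrite -iter_porbit_fix (@iter_fiber_id s).
Qed.

(** Going twice around the necklace preserves the order, so the cycle closes
    after at most two turns. *)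
Lemma card_porbit_odd x : x \in fiber p f s ->
  #|porbit p x| = if iter l p x == x then l else l.*2.
Proof.
move=> xs; have d1 := dvd_porbit_fiber xs.
have d2 : #|porbit p x| %| l.*2.
  rewrite -iter_porbit_fix; apply/eqP/(@iter_fiber_id s) => //.
    by rewrite -addnn iterD !sl.
  by rewrite -addnn parityD sl addbb.
rewrite iter_porbit_fix; case: ifP => [d3|]; first by apply/eqP; rewrite eqn_dvd d1 d3.
case/dvdnP: d1 => e E; rewrite E in d2 *.
have e2 : e %| 2 by rewrite -(dvdn_pmul2r l_gt0) mul2n.
have e_le := dvdn_leq (isT : 0 < 2) e2.
have e0 : 0 < e by rewrite lt0n; apply: contraTneq e2 => ->.
have [->|->] : e = 1 \/ e = 2 by lia.
  by rewrite mul1n dvdnn.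
by rewrite mul2n.
Qed.

Lemma card_fiber_fixed : parity s l ->
  #|[set x in fiber p f s | iter l p x == x]| = odd M.
Proof.
move=> od.
have qE x : (p ^+ l)%g x = iter l p x by rewrite permX.
rewrite -(@card_fixed_reversal n (fiber p f s) (p ^+ l)%g).
- by apply: eq_card => x; rewrite !inE qE.
- by move=> x; rewrite !inE qE -itinerary_iter => /eqP ->; rewrite sl.
- move=> x xs; rewrite !qE -iterD addnn; apply: (@iter_fiber_id s) => //.
    by rewrite -addnn iterD !sl.
  by rewrite -addnn parityD sl addbb.
by move=> x y xs ys xy; rewrite !qE (fiber_iter_lt l xs ys xy) od.
Qed.

Lemma card_fiber_cycle i :
  #|[set x in fiber p f s | #|porbit p x| == i]| =
  (l == i) * short_cycles (parity s l) M + (l.*2 == i) * (long_cycles (parity s l) M).*2.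
Proof.
have ll : l != l.*2 by rewrite -addnn -[l in l != _]addn0 eqn_add2l eq_sym -lt0n.
case: (boolP (parity s l)) => [od|/negbTE ev] /=.
  have ME := odd_double_half M; have FE := card_fiber_fixed od.
  have ME2 := cardsID [set x | iter l p x == x] (fiber p f s).
  have FE' : #|fiber p f s :&: [set x | iter l p x == x]| = odd M.
    by rewrite -FE; apply: eq_card => x; rewrite !inE.
  rewrite FE' -/M -{2}ME in ME2; move/addnI in ME2.
  have cond x : x \in fiber p f s -> (#|porbit p x| == i) =
      (if iter l p x == x then l == i else l.*2 == i).
    by move=> /card_porbit_odd ->; case: ifP.
  have [li|li] := eqVneq l i.
    have li2 : (l.*2 == i) = false by rewrite -li eq_sym (negbTE ll).
    rewrite li2 mul1n mul0n addn0 -FE; apply: eq_card => x.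
    rewrite !inE; apply: andb_id2l => xs; rewrite cond ?inE // li2 -{1}li eqxx.
    by case: eqP.
  have [li2|li2] := eqVneq l.*2 i.
    rewrite mul0n mul1n add0n -ME2; apply: eq_card => x; rewrite !inE [RHS]andbC.
    apply: andb_id2l => xs; rewrite cond ?inE // (negbTE li) li2 eqxx.
    by case: eqP.
  rewrite !mul0n; apply: eq_card0 => x; rewrite !inE; apply/negP => /andP[xs].
  by rewrite cond ?inE // (negbTE li) (negbTE li2); case: eqP.
rewrite /short_cycles /long_cycles muln0 addn0; have [li|li] := eqVneq l i.
  rewrite mul1n; apply: eq_card => x; rewrite !inE; apply: andb_idr => xs.
  by rewrite card_porbit_even ?inE // li.
rewrite mul0n; apply: eq_card0 => x; rewrite !inE; apply/negP => /andP[xs].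
by rewrite card_porbit_even ?inE // (negbTE li).
Qed.

End Fiber.

Lemma Ncyc_points i : \sum_(x : 'I_n | #|porbit p x| == i) 1 = i * Ncyc p i.
Proof.
rewrite (partition_big (porbit p)
  (fun C : {set 'I_n} => (C \in porbits p) && (#|C| == i))) /=; last first.
  by move=> x ->; rewrite imset_f.
rewrite (eq_bigr (fun=> i)); last first.
  move=> C /andP[/imsetP[y _ ->] /eqP <-]; rewrite -[RHS]sum1_card.
  apply: eq_bigl => x; rewrite eq_porbit_mem andb_idl // -eq_porbit_mem.
  by move/eqP->.
by rewrite sum_nat_const mulnC; congr (_ * _); apply: eq_card => C; rewrite !inE.
Qed.

Definition necklace_mult C : nat := occupancy C %/ #|C|.

Lemma necklace_multE s C : C \in porbits T -> s \in C -> necklace_mult C = #|fiber p f s|.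
Proof.
move=> CT sC; rewrite /necklace_mult (occupancyE CT sC) mulKn //.
by apply/card_gt0P; exists s.
Qed.

Lemma occupancy_mult C : C \in porbits T -> occupancy C = #|C| * necklace_mult C.
Proof.
move=> CT; have /imsetP[s _ Cs] := CT.
have sC : s \in C by rewrite Cs porbit_id.
by rewrite (necklace_multE CT sC) (occupancyE CT sC).
Qed.

(** Both sides are multiplied by i, which turns cycles into points; points are
    then sorted by itinerary. *)
Lemma NcycE i : 0 < i -> Ncyc p i =
  \sum_(C in porbits T) ((#|C| == i) * short_cycles (necklace_odd C) (necklace_mult C)
                + (#|C|.*2 == i) * long_cycles (necklace_odd C) (necklace_mult C)).
Proof.
move=> i0; apply/eqP; rewrite -(eqn_pmul2l i0) -Ncyc_points; apply/eqP.
rewrite (partition_big It xpredT) //= (@sum_porbits _ T nat) /= big_distrr /=.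
apply: eq_bigr => C CT; have /imsetP[s0 _ Cs] := CT.
rewrite (eq_bigr (fun=> (#|C| == i) * short_cycles (necklace_odd C) (necklace_mult C)
  + (#|C|.*2 == i) * (long_cycles (necklace_odd C) (necklace_mult C)).*2)); last first.
  move=> s sC; have Es : porbit T s = C by apply/eqP; rewrite Cs eq_porbit_mem -Cs.
  have := card_fiber_cycle s i; rewrite Es (parity_necklace CT sC) (necklace_multE CT sC) => <-.
  rewrite -sum1_card; apply: eq_bigl => x; rewrite !inE andbC //.
rewrite sum_nat_const; move: (short_cycles _ _) (long_cycles _ _) => a b.
move: #|C| => c; case: (eqVneq c i) => [E1|_]; case: (eqVneq c.*2 i) => [E2|_];
  rewrite ?mul1n ?mul0n ?add0n ?addn0 ?muln0 //.
- lia.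
- by rewrite E1.
- by rewrite -E2 -muln2 -!muln2; lia.
Qed.

End CycleType.

(** * Compatible pairs and multisets of necklaces *)

(** The points are sorted by their letter in w, ties being broken upwards or
    downwards according to the parity of the letter. *)
Lemma compatible_sort n r (w : {ffun 'I_n -> 'I_r}) :
  exists p : 'S_n, compatible p [ffun x => w (p x)].
Proof.
pose le (a b : 'I_n) := (w a < w b) || (w a == w b) && (if odd (w a) then b <= a else a <= b).
have le_total : total le.
  move=> a b; rewrite /le -!val_eqE /=; case: ltngtP => //= ->.
  by case: odd; case: (ltngtP a b).
have le_tr : transitive le.
  move=> b a c; rewrite /le -!val_eqE /=.
  case: (ltngtP (w a) (w b)) => //= [ab|->].
    by move=> _ /orP[/(ltn_trans ab)->//|/andP[/eqP <-]]; rewrite ab.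
  move=> h /orP[->//|/andP[-> h2]]; rewrite /= orbC; move: h h2.
  case: odd => h1 h2; first by rewrite (leq_trans h2 h1).
  by rewrite (leq_trans h1 h2).
pose s := sort le (enum 'I_n).
have ss : size s = n by rewrite size_sort size_enum_ord.
have us : uniq s by rewrite sort_uniq enum_uniq.
(* Taking i itself as the default value covers the case n = 0, in which there
   is no point to name. *)
pose q (i : 'I_n) := nth i s i.
have qE (i j : 'I_n) : q i = nth j s i by apply: set_nth_default; rewrite ss.
have inj : injective q.
  move=> i j /eqP; rewrite (qE i j) /q nth_uniq ?ss // => /eqP; exact: val_inj.
exists (perm inj); apply/compatibleP => i j ij.
have : le (q i) (q j).
  rewrite (qE i j); apply: (sorted_ltn_nth le_tr j (sort_sorted le_total _)) => //.
    by rewrite inE -/s ss.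
  by rewrite inE -/s ss.
have ab : q i != q j by rewrite (inj_eq inj) -val_eqE /= ltn_eqF.
rewrite /compat_rel !ffunE !permE /le => /orP[->//|/andP[-> ab']].
apply/orP; right; move: ab ab'; rewrite -val_eqE /=.
by case: odd; case: ltngtP.
Qed.

Section Bijection.
Variables n r : nat.
Local Notation N := n`!.
Local Notation T := (shift N r).
Local Notation word := {ffun 'I_N -> 'I_r}.
Local Notation necklace := {C : {set word} | C \in porbits T}.

Definition compatible_pairs : {set 'S_n * {ffun 'I_n -> 'I_r}} :=
  [set pf : 'S_n * {ffun 'I_n -> 'I_r} | compatible pf.1 pf.2].

(** The multiset of necklaces of a pair, recorded by the number of points whose
    itinerary belongs to the necklace, that is, by length times multiplicity.
    This is the exponent of x contributed by the necklace. *)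
Definition occ_data (pf : 'S_n * {ffun 'I_n -> 'I_r}) :
    {ffun necklace -> 'I_n.+1} :=
  [ffun C : necklace => inord (occupancy pf.1 pf.2 (val C))].

Definition valid_data : {set {ffun necklace -> 'I_n.+1}} :=
  [set h : {ffun necklace -> 'I_n.+1} | (\sum_C h C == n)
     && [forall C : necklace, #|val C| %| h C]].

Lemma occ_dataE pf C : occ_data pf C = occupancy pf.1 pf.2 (val C) :> nat.
Proof.
rewrite ffunE inordK // ltnS /occupancy -[n in _ <= n]card_ord.
exact: max_card.
Qed.

Lemma occ_data_inj : {in compatible_pairs &, injective occ_data}.
Proof.
move=> [p f] [p' f']; rewrite !inE /= => pf pf' E.
suff [-> ->] : p = p' /\ f = f' by [].
apply: compatible_uniq => // s.
have CT : porbit T s \in porbits T by apply: imset_f.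
have sC := porbit_id T s.
have := occ_dataE (p, f) (exist (fun C : {set word} => C \in porbits T) _ CT).
rewrite E occ_dataE /=.
rewrite !(occupancyE _ _ CT sC) => /eqP; rewrite eqn_pmul2l.
  by move/eqP.
by apply/card_gt0P; exists s.
Qed.

Lemma occ_data_valid pf : occ_data pf \in valid_data.
Proof.
rewrite inE; apply/andP; split.
  have := sum_occupancy pf.1 pf.2; rewrite big_sub /= => E.
  by rewrite -[X in _ == X]E; apply/eqP/eq_bigr => C _; rewrite occ_dataE.
by apply/forallP => C; rewrite occ_dataE occupancy_mult ?dvdn_mulr // (valP C).
Qed.

Lemma card_compatible : r ^ n <= #|compatible_pairs|.
Proof.
have -> : r ^ n = #|{ffun 'I_n -> 'I_r}| by rewrite card_ffun !card_ord.
pose F (w : {ffun 'I_n -> 'I_r}) : 'S_n * {ffun 'I_n -> 'I_r} :=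
  let p := xchoose (compatible_sort w) in (p, [ffun x => w (p x)]).
have Finj : injective F.
  move=> w w' [-> /ffunP E]; apply/ffunP => x.
  have := E ((xchoose (compatible_sort w'))^-1 x)%g.
  by rewrite !ffunE !permKV.
rewrite -(card_imset _ Finj) subset_leq_card //.
apply/subsetP => _ /imsetP[w _ ->]; rewrite inE.
exact: (xchooseP (compatible_sort w)).
Qed.

(** An injection between finite sets of the same size is onto, so counting
    replaces the construction of an inverse. *)
Lemma occ_data_onto : #|valid_data| = r ^ n ->
  occ_data @: compatible_pairs = valid_data.
Proof.
move=> cD; apply/eqP; rewrite eqEcard; apply/andP; split.
  by apply/subsetP => _ /imsetP[pf _ ->]; apply: occ_data_valid.
rewrite cD card_in_imset ?card_compatible //; exact: occ_data_inj.
Qed.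

End Bijection.

Local Open Scope ring_scope.

(** * Weights of necklaces *)

Section Geometric.
Variable R : comNzRingType.
Implicit Types (c : R) (l : nat).

Definition geom c l : fps R :=
  Fps (fun h => if (l %| h)%N then c ^+ (h %/ l) else 0).
(** The logarithmic derivative of [geom]: see [euler_geom]. *)
Definition dlog_geom c l : fps R :=
  Fps (fun h => if (0 < h)%N && (l %| h)%N then c ^+ (h %/ l) *+ l else 0).

Lemma geom0 c l : fcoef (geom c l) 0 = 1.
Proof. by rewrite /= dvdn0 div0n. Qed.

Lemma geom_shift c l h : (0 < l)%N ->
  fcoef (fpsC c * fpsX R ^+ l * geom c l) h =
  if (0 < h)%N && (l %| h)%N then c ^+ (h %/ l) else 0.
Proof.
move=> l0; rewrite -mulrA fcoefCM fcoefXnM; case: (leqP l h) => lh.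
  have -> : (l %| h)%N = (l %| h - l)%N by rewrite -{1}(subnK lh) dvdn_addl.
  rewrite (leq_trans l0 lh) /=.
  case: ifP => d; last by rewrite mulr0.
  by rewrite -exprS -[in RHS](subnK lh) divnDr ?dvdnn // divnn l0 addn1.
rewrite mulr0; case: h lh => // h lh /=.
by rewrite gtnNdvd.
Qed.

Lemma geom_inv c l : (0 < l)%N -> (1 - fpsC c * fpsX R ^+ l) * geom c l = 1.
Proof.
move=> l0; apply: fpsP => h.
rewrite mulrBl mul1r fcoefD fcoefN geom_shift // fcoef1.
case: h => [|h]; first by rewrite geom0 subr0.
by rewrite /= subrr.
Qed.

Lemma dlog_geomE c l : (0 < l)%N ->
  dlog_geom c l = fpsC c * fpsX R ^+ l * geom c l *+ l.
Proof.
move=> l0; apply: fpsP => h; rewrite fcoefMn geom_shift //=.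
by case: ifP => //; rewrite mul0rn.
Qed.

Lemma euler_geom c l : (0 < l)%N -> euler (geom c l) = dlog_geom c l * geom c l.
Proof.
move=> l0; have G := geom_inv c l0.
set Z := fpsC c * fpsX R ^+ l; rewrite -/Z in G.
have EZ : euler Z = Z *+ l by rewrite /Z eulerCM eulerXk mulrnAr.
have : euler ((1 - Z) * geom c l) = 0 by rewrite G euler1.
rewrite eulerM eulerD euler1 eulerN add0r EZ mulNr => /eqP.
rewrite addrC subr_eq0 => /eqP E.
rewrite dlog_geomE // -/Z -[LHS]mulr1 -[in LHS]G mulrA [euler _ * _]mulrC E.
by rewrite -mulrnAl.
Qed.

Lemma euler_1DX c l : (0 < l)%N ->
  euler (1 + fpsC c * fpsX R ^+ l) =
  - dlog_geom (- c) l * (1 + fpsC c * fpsX R ^+ l).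
Proof.
move=> l0; have := geom_inv (- c) l0.
rewrite rmorphN mulNr opprK dlog_geomE // rmorphN.
set Z := fpsC c * fpsX R ^+ l => G.
have EZ : euler Z = Z *+ l by rewrite /Z eulerCM eulerXk mulrnAr.
move: (geom _ _) G => g G; have -> : - (- fpsC c * fpsX R ^+ l * g *+ l) = Z * g *+ l.
  by rewrite !mulNr mulNrn opprK.
rewrite eulerD euler1 add0r EZ mulrnAl -mulrA.
by rewrite [g * _]mulrC G mulr1.
Qed.

End Geometric.

Section NecklaceSeries.
Variables n r : nat.
Local Notation N := n`!.
Local Notation N0 := (fact_gt0 n).
Local Notation at_ := (letter_at N0).
Local Notation T := (shift N r).
Local Notation word := {ffun 'I_N -> 'I_r}.
Local Notation necklace := {C : {set word} | C \in porbits T}.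

Lemma card_necklace_gt0 (C : {set word}) : C \in porbits T -> (0 < #|C|)%N.
Proof. by case/imsetP=> s _ ->; rewrite lt0n card_porbit_neq0. Qed.

Section Weights.
Variables (R : comNzRingType) (u : 'I_r -> R) (z : nat -> R).

Definition necklace_wt (C : {set word}) : R := \prod_(s in C) u (at_ s 0).

(** Total weight of the points of a necklace of multiplicity m and of the cycles
    they form. *)
Definition local_wt (C : {set word}) m : R :=
  necklace_wt C ^+ m * (z #|C| ^+ short_cycles (necklace_odd C) m
                         * z #|C|.*2 ^+ long_cycles (necklace_odd C) m).

Definition local_series (C : {set word}) : fps R :=
  Fps (fun h => if (#|C| %| h)%N then local_wt C (h %/ #|C|) else 0).

(** A choice of exponents contributes only if each is a multiple of the length
    of its necklace. *)
Lemma fcoef_prod_local :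
  fcoef (\prod_(C in porbits T) local_series C) n =
  \sum_(h in valid_data n r) \prod_(C : necklace) local_wt (val C) (h C %/ #|val C|).
Proof.
rewrite big_sub fcoef_prod big_mkcond [RHS]big_mkcond /=.
apply: eq_bigr => h _; rewrite inE; case: (_ == n) => //=.
case: (boolP [forall _, _]) => [/forallP H|]; first by apply: eq_bigr => C _; rewrite H.
rewrite negb_forall => /existsP[C nC].
by rewrite (bigD1 C) //= (negbTE nC) mul0r.
Qed.

Lemma compatible_wt (p : 'S_n) (f : {ffun 'I_n -> 'I_r}) : compatible p f ->
  (\prod_x u (f x)) * \prod_(1 <= i < n.+1) z i ^+ Ncyc p i =
  \prod_(C in porbits T) local_wt C (necklace_mult p f C).
Proof.
move=> pf; rewrite !big_split /=; congr (_ * _).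
  rewrite (eq_bigr (fun x => u (at_ (itinerary p f x) 0))); last first.
    by move=> x _; rewrite letter_itinerary.
  rewrite (partition_big (fun x => porbit T (itinerary p f x)) (mem (porbits T))) /=; last first.
    by move=> x _; apply: imset_f.
  apply: eq_bigr => C CT; rewrite /necklace_wt -prodrXl.
  rewrite (partition_big (itinerary p f) (mem C)) /=; last first.
    by move=> x; have /imsetP[s _ ->] := CT; rewrite eq_porbit_mem.
  apply: eq_bigr => s sC; rewrite (necklace_multE p f CT sC).
  rewrite (eq_bigr (fun=> u (at_ s 0))); last by move=> x /andP[_ /eqP ->].
  rewrite prodr_const; congr (_ ^+ _); apply: eq_card => x; rewrite !inE.
  apply: andb_idl => /eqP ->; have /imsetP[s' _ E] := CT.
  by rewrite E eq_porbit_mem -E.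
rewrite -big_split /= (eq_big_nat _ _ (F2 := fun i => \prod_(C in porbits T)
   (z i ^+ ((#|C| == i) * short_cycles (necklace_odd C) (necklace_mult p f C))%N
  * z i ^+ ((#|C|.*2 == i) * long_cycles (necklace_odd C) (necklace_mult p f C))%N))); last first.
  move=> i /andP[i0 _]; rewrite (NcycE pf i0) expr_sum.
  by apply: eq_bigr => C _; rewrite exprD.
rewrite exchange_big /=; apply: eq_bigr => C CT.
have C0 := card_necklace_gt0 CT.
have Cn : (#|C| * necklace_mult p f C <= n)%N.
  by rewrite -occupancy_mult // /occupancy -[n in (_ <= n)%N]card_ord; apply: max_card.
(* An exponent a > 0 forces its index to be a cycle length, at most n. *)
have one (i0 a : nat) : (0 < i0)%N -> ((0 < a)%N -> (i0 <= n)%N) ->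
    \prod_(1 <= i < n.+1) z i ^+ ((i0 == i) * a)%N = z i0 ^+ a.
  move=> i00 ia; case: a ia => [|a] ia.
    by rewrite big1 // => i _; rewrite muln0.
  rewrite (bigD1_seq i0) ?iota_uniq ?mem_index_iota ?i00 ?ltnS ?ia //=.
  rewrite eqxx mul1n big1 ?mulr1 // => i ii0.
  by rewrite eq_sym (negbTE ii0).
rewrite big_split /= !one ?double_gt0 //.
  rewrite /long_cycles; case: necklace_odd => //; rewrite half_gt0 => m2.
  by apply: leq_trans Cn; rewrite -muln2 leq_mul2l m2 orbT.
rewrite /short_cycles => m0; apply: leq_trans Cn; rewrite leq_pmulr //.
by move: m0; case: necklace_odd => //; case: (necklace_mult _ _ _).
Qed.

End Weights.
End NecklaceSeries.

(** * Sums of the Moebius function *)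

(** A factor p that already divides d makes p d non-squarefree, a new one
    changes the sign. *)
Lemma mobius_primeM p d : prime p -> (0 < d)%N ->
  mobius (p * d) = if (p %| d)%N then 0 else - mobius d.
Proof.
move=> pp d0; have p0 := prime_gt0 pp.
have pM : p \in primes (p * d) by rewrite mem_primes pp muln_gt0 p0 d0 dvdn_mulr.
case: ifP => pd; rewrite /mobius.
  case: allP => // /(_ p pM); rewrite lognM // (pfactorK 1) //.
  by rewrite (_ : logn p d = (logn p d).-1.+1) // prednK // logn_gt0 mem_primes pp d0.
have pE : perm_eq (primes (p * d)) (p :: primes d).
  apply: uniq_perm; rewrite /= ?primes_uniq ?mem_primes ?pd ?andbF //.
  by move=> q; rewrite primesM // primes_prime // !inE.
rewrite (perm_size pE) (perm_all _ pE) /= lognM // (pfactorK 1) //.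
rewrite logn_coprime ?prime_coprime ?pd // eqxx /=.
rewrite (eq_in_all (a2 := fun q => logn q d == 1%N)).
  by case: ifP; rewrite ?oppr0 // exprS mulN1r.
move=> q; rewrite mem_primes => /and3P[qq _ qd]; rewrite lognM // logn_prime //.
by have [qp|] := eqVneq q p; rewrite // -qp qd in pd.
Qed.

Lemma big_divisors_eq (R : nmodType) (P Q : pred nat) m n (F : nat -> R) :
  (0 < m)%N -> (0 < n)%N ->
  (forall d, (d %| m)%N && P d = (d %| n)%N && Q d) ->
  \sum_(d <- divisors m | P d) F d = \sum_(d <- divisors n | Q d) F d.
Proof.
move=> m0 n0 PQ; rewrite -big_filter -[RHS]big_filter; apply: perm_big.
apply: uniq_perm; rewrite ?filter_uniq ?divisors_uniq // => d.
by rewrite !mem_filter -!dvdn_divisors // andbC PQ andbC.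
Qed.

Lemma big_divisors_mul (R : nmodType) k n (F : nat -> R) : (0 < k * n)%N ->
  \sum_(d <- divisors (k * n) | (k %| d)%N) F d = \sum_(d <- divisors n) F (k * d)%N.
Proof.
move=> kn0; have := kn0; rewrite muln_gt0 => /andP[k0 n0].
have kinj : injective (muln k).
  by move=> a b /eqP; rewrite eqn_pmul2l // => /eqP.
rewrite -[RHS](big_map (muln k) xpredT F) -[LHS]big_filter.
apply: perm_big.
apply: uniq_perm; rewrite ?filter_uniq ?divisors_uniq ?map_inj_uniq ?divisors_uniq //.
move=> d; rewrite mem_filter -dvdn_divisors //; apply/andP/mapP.
  case=> /dvdnP[e ->]; rewrite mulnC dvdn_pmul2l // => en.
  by exists e => //; rewrite -dvdn_divisors.
case=> e; rewrite -dvdn_divisors // => en ->.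
by rewrite dvdn_mulr // dvdn_pmul2l.
Qed.

(** For a prime p dividing n, the divisors d prime to p cancel against p d,
    and the remaining ones are divisible by p^2, so that mu vanishes there. *)
Lemma sum_mobius n : (0 < n)%N -> \sum_(d <- divisors n) mobius d = (n == 1%N)%:R.
Proof.
move=> n0; have [->|n_neq1] := eqVneq n 1%N; first by rewrite big_seq1.
have n1 : (1 < n)%N by rewrite ltn_neqAle eq_sym n_neq1.
have pp := pdiv_prime n1; have p0 := prime_gt0 pp.
(* The smallest prime divisor of n serves as p. *)
have [m nE] := dvdnP (pdiv_dvd n); move: (pdiv n) pp p0 nE => p pp p0 nE.
rewrite mulnC in nE; rewrite nE in n0 * => {n_neq1}.
have m0 : (0 < m)%N by move: n0; rewrite muln_gt0 => /andP[].
rewrite (bigID (fun d => p %| d)%N) /= big_divisors_mul //.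
rewrite (@eq_big_seq _ _ _ _ _ _ (fun d => if (~~ (p %| d))%N then - mobius d else 0)); last first.
  move=> d; rewrite -dvdn_divisors // => dm.
  by rewrite mobius_primeM ?(dvdn_gt0 m0 dm) //; case: (p %| d)%N.
rewrite -big_mkcond sumrN; apply/eqP; rewrite addrC subr_eq0; apply/eqP.
apply: big_divisors_eq => // d; apply: andb_id2r => pd.
by rewrite Gauss_dvdr // coprime_sym prime_coprime.
Qed.

(** The sign of e/d is -1 plus twice the indicator of e/d being even, and then
    d ranges over the divisors of e/2. *)
Lemma sum_mobius_sign e : (0 < e)%N ->
  \sum_(d <- divisors e) mobius d * (-1) ^+ (e %/ d) =
  - (e == 1%N)%:R + (e == 2%N)%:R *+ 2.
Proof.
move=> e0; have signE k : (-1) ^+ k = -1 + (if odd k then 0 else 1) *+ 2 :> int.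
  by rewrite -signr_odd; case: odd; rewrite ?expr1 ?expr0 // mul0rn addr0.
rewrite (eq_bigr (fun d => - mobius d + (if odd (e %/ d) then 0 else mobius d) *+ 2)); last first.
  by move=> d _; rewrite signE mulrDr mulrN1 mulrnAr; case: odd; rewrite ?mulr0 ?mulr1.
rewrite big_split /= sumrN sum_mobius // sumrMnl; congr (_ + _ *+ _).
have [eodd|] := boolP (odd e).
  rewrite big_seq big1 => [|d]; first by case: eqP eodd => // ->.
  rewrite -dvdn_divisors // => de; move: eodd; rewrite -{1}(divnK de) oddM.
  by case: odd.
move=> eev; have [f fE] : exists f, e = (2 * f)%N.
  by exists e./2; rewrite mul2n even_halfK.
rewrite fE in e0 *; have f0 : (0 < f)%N by lia.
have -> : (2 * f == 2)%N = (f == 1)%N by lia.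
rewrite -sum_mobius // (eq_bigr (fun d => if ~~ odd (2 * f %/ d) then mobius d else 0)).
  rewrite -big_mkcond; apply: big_divisors_eq => // d; rewrite andbT.
  apply/andP/idP => [[/dvdnP[k kE]]|df].
    have d0 : (0 < d)%N by case: d kE => // /eqP; rewrite muln0 eqn0Ngt e0.
    rewrite kE mulnK // => kev; have k2 := even_halfK kev.
    by apply/dvdnP; exists k./2; lia.
  rewrite dvdn_mull //; split=> //; have d0 := dvdn_gt0 f0 df.
  by rewrite -muln_divA // oddM.
by move=> d _; case: odd.
Qed.

(** The odd divisors of i are the divisors of its odd part. *)
Lemma sum_mobius_odd i : (0 < i)%N ->
  \sum_(d <- divisors i | odd d) mobius d = [exists j : 'I_i, i == (2 ^ j)%N]%:R.
Proof.
move=> i0; have [o] := pfactor_coprime (isT : prime 2) i0.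
rewrite coprime2n; move: (logn 2 i) => k oodd iE.
have o0 : (0 < o)%N by case: o oodd {iE}.
transitivity (\sum_(d <- divisors o) mobius d).
  apply: big_divisors_eq => // d; rewrite andbT iE.
  apply/andP/idP => [[d_i d_odd]|d_o]; last first.
    by split; [apply: dvdn_mulr | apply: dvdn_odd oodd].
  by move: d_i; rewrite Gauss_dvdl // coprimeXr // coprimen2.
rewrite sum_mobius //; congr (nat_of_bool _)%:R; apply/eqP/existsP => [o1|[j /eqP ij]].
  have ki : (k < i)%N by rewrite iE o1 mul1n ltn_expl.
  by exists (Ordinal ki); rewrite /= {1}iE o1 mul1n.
have : (o %| 2 ^ j)%N by rewrite -ij iE dvdn_mulr.
case/dvdn_pfactor => // -[|m] _ oE; first by rewrite oE.
by rewrite oE oddX in oodd.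
Qed.

(** * Logarithmic derivative of the necklace product *)

(** A number of points m l is split as the parity of m plus twice its half. *)
Lemma fcoef_short_long (R : comNzRingType) (c c2 : R) l h : (0 < l)%N ->
  fcoef ((1 + fpsC c * fpsX R ^+ l) * geom c2 l.*2) h =
  if (l %| h)%N then c ^+ odd (h %/ l) * c2 ^+ (h %/ l)./2 else 0.
Proof.
move=> l0; rewrite mulrDl mul1r fcoefD -mulrA fcoefCM fcoefXnM /=.
have dE m : (l.*2 %| m * l)%N = ~~ odd m by rewrite -mul2n dvdn_pmul2r // dvdn2.
have vE m : (m * l %/ l.*2 = m./2)%N by rewrite -mul2n divnMr // divn2.
have [/dvdnP[m ->]|lh] := boolP (l %| h)%N; last first.
  have -> : (l.*2 %| h)%N = false.
    by apply: contraNF lh; apply: dvdn_trans; rewrite -muln2 dvdn_mulr.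
  case: (leqP l h) => hl; last by rewrite mulr0 addr0.
  have -> : (l.*2 %| h - l)%N = false; last by rewrite mulr0 addr0.
  apply: contraNF lh => d2; rewrite -(subnK hl) dvdn_addl //.
  by apply: dvdn_trans d2; rewrite -muln2 dvdn_mulr.
rewrite mulnK // dE vE; case: m => [|m].
  by rewrite mul0n leqNgt l0 /= mulr0 addr0 mul1r.
rewrite -[X in (_ <= X)%N]/(m.+1 * l)%N leq_pmull //.
have -> : (m.+1 * l - l = m * l)%N by rewrite mulSn addKn.
rewrite dE vE /= uphalf_half.
case: (odd m); first by rewrite mulr0 addr0 expr0 mul1r.
by rewrite add0r expr1.
Qed.

Section PowerSums.
Variables (n r : nat) (R : comNzRingType).
Local Notation N := n`!.
Local Notation N0 := (fact_gt0 n).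
Local Notation at_ := (letter_at N0).
Local Notation T := (shift N r).
Local Notation word := {ffun 'I_N -> 'I_r}.

Lemma prod_period (F : 'I_r -> R) (s : word) k :
  \prod_(j < k * #|porbit T s|) F (at_ s j) =
  (\prod_(w in porbit T s) F (at_ w 0)) ^+ k.
Proof.
elim: k => [|k IHk]; first by rewrite big_ord0.
rewrite mulSn big_split_ord /= exprS -IHk; congr (_ * _).
  rewrite (@big_porbit _ T _ _ _ (fun w => F (at_ w 0))).
  by apply: eq_bigr => j _; rewrite letter_at_iter.
apply: eq_bigr => j _; rewrite addnC -letter_at_iter.
by rewrite iter_porbit.
Qed.

Lemma sum_periodic_words (F : 'I_r -> R) l : (0 < l)%N -> (l %| N)%N ->
  \sum_(s : word | iter l T s == s) \prod_(j < l) F (at_ s j)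
  = (\sum_a F a) ^+ l.
Proof.
move=> l0 lN; have -> : (\sum_a F a) ^+ l = \prod_(j < l) \sum_a F a.
  by rewrite prodr_const card_ord.
rewrite bigA_distr_bigA /=.
(* A word of length l is extended periodically. *)
pose h (g : {ffun 'I_l -> 'I_r}) : word := [ffun i : 'I_N => g (Ordinal (ltn_pmod i l0))].
pose h' (s : word) : {ffun 'I_l -> 'I_r} := [ffun j : 'I_l => at_ s j].
have hE g m : at_ (h g) m = g (Ordinal (ltn_pmod m l0)).
  by rewrite /letter_at ffunE; congr (g _); apply: val_inj; rewrite /= modn_dvdm.
rewrite (reindex_onto h h') /=; last first.
  move=> s /eqP ss; apply: (letter_at_inj (N_gt0 := N0)) => m _.
  rewrite hE ffunE /= [in RHS](divn_eq m l) addnC.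
  elim: (m %/ l)%N => [|k IHk]; first by rewrite addn0.
  by rewrite mulSn addnCA addnC -letter_at_iter ss.
apply: eq_big => [g|g _].
  apply/andP; split.
    apply/eqP/(letter_at_inj (N_gt0 := N0)) => m _; rewrite letter_at_iter !hE.
    by congr (g _); apply: val_inj; rewrite /= modnDr.
  apply/eqP/ffunP => j; rewrite ffunE hE; congr (g _); apply: val_inj.
  by rewrite /= modn_small.
apply: eq_bigr => j _; rewrite hE; congr (F (g _)); apply: val_inj.
by rewrite /= modn_small.
Qed.

(** The l-th power of the sum over letters is a sum over words of length l, that
    is, over periodic sequences whose period divides l.  Such a word consists
    of repetitions of the necklace of the sequence. *)
Lemma power_sum (F : 'I_r -> R) l : (0 < l)%N -> (l %| N)%N ->
  (\sum_a F a) ^+ l =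
  \sum_(s : word | (#|porbit T s| %| l)%N)
    (\prod_(w in porbit T s) F (at_ w 0)) ^+ (l %/ #|porbit T s|).
Proof.
move=> l0 lN; rewrite -sum_periodic_words //.
apply: eq_big => [s|s]; first exact: iter_porbit_fix.
by rewrite iter_porbit_fix => sl; rewrite -prod_period divnK.
Qed.

Variables (u : 'I_r -> R) (z : nat -> R).
Implicit Types (C : {set word}).

(** The term contributed by a letter to the q-th power sum of the alphabet: u^q
    for an even letter and -(-u)^q for an odd one. *)
Definition signed_wt q (a : 'I_r) : R :=
  (-1) ^+ odd a * ((-1) ^+ odd a * u a) ^+ q.

Definition signed_power_sum q : R := \sum_a signed_wt q a.

(** The inner sum of the exponents in (a), for an arbitrary weighted alphabet. *)
Definition cycle_coef i m : R :=
  \sum_(d <- divisors i) (mobius d)%:~R * signed_power_sum (d * m) ^+ (i %/ d).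

(** What is left of [cycle_coef] for one periodic sequence after Moebius
    inversion: only sequences of period i, or of period i/2 with an odd number
    of odd letters, survive. *)
Definition necklace_coef C i m : R :=
  let U := necklace_wt u C in
  if necklace_odd C
  then - ((- U) ^+ m *+ (#|C| == i)) + U ^+ m.*2 *+ (#|C|.*2 == i) *+ 2
  else U ^+ m *+ (#|C| == i).

Lemma prod_signed_wt q C :
  \prod_(w in C) signed_wt q (at_ w 0) =
  (-1) ^+ necklace_odd C * ((-1) ^+ necklace_odd C * necklace_wt u C) ^+ q.
Proof.
rewrite big_split /= prodrXl big_split /=.
suff -> : \prod_(w in C) (-1) ^+ odd (at_ w 0) = (-1) ^+ necklace_odd C :> R by [].
by rewrite /necklace_odd signr_odd expr_sum.
Qed.

(** For a sequence of period l dividing i, with e = i/l, the sum over d collapses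
    to the sum over d | e of mu(d), or of mu(d) times the sign of e/d when the
    number of odd letters in a period is odd. *)
Lemma cycle_coefE i m : (0 < i)%N -> (i %| N)%N ->
  cycle_coef i m = \sum_(s : word) necklace_coef (porbit T s) i m.
Proof.
move=> i0 iN; rewrite /cycle_coef.
pose G s d := (mobius d)%:~R *
   (\prod_(w in porbit T s) signed_wt (d * m) (at_ w 0)) ^+ (i %/ d %/ #|porbit T s|).
transitivity (\sum_(s : word) \sum_(d <- divisors i | (#|porbit T s| %| i %/ d)%N) G s d).
  under [RHS]eq_bigr => s _ do rewrite big_mkcond.
  rewrite exchange_big /= [LHS]big_seq [RHS]big_seq; apply: eq_bigr => d.
  rewrite -dvdn_divisors // => di; rewrite -big_mkcond /=.
  have id0 : (0 < i %/ d)%N by rewrite divn_gt0 ?(dvdn_gt0 i0 di) // dvdn_leq.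
  have idN : (i %/ d %| N)%N by apply: dvdn_trans iN; apply: dvdn_div.
  by rewrite /signed_power_sum power_sum // mulr_sumr.
apply: eq_bigr => s _; rewrite /G {G}.
have := prod_signed_wt ^~ (porbit T s); rewrite /necklace_coef => PE.
under eq_bigr => d _ do rewrite PE.
have l0 : (0 < #|porbit T s|)%N by rewrite lt0n card_porbit_neq0.
move: {PE} #|_| (necklace_wt u _) (necklace_odd _) l0 => l U b l0.
have [/dvdnP[e ie]|li] := boolP (l %| i)%N; last first.
  rewrite big1_seq.
    have -> : (l == i) = false by apply: contraNF li => /eqP->.
    have -> : (l.*2 == i) = false by apply: contraNF li => /eqP<-; rewrite -muln2 dvdn_mulr.
    by rewrite !mulr0n mul0rn oppr0 addr0; case: b.
  move=> d /andP[ld]; rewrite -dvdn_divisors // => di.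
  by rewrite (dvdn_trans ld (dvdn_div di)) in li.
have e0 : (0 < e)%N by case: e ie i0 => // ->.
rewrite (@big_divisors_eq _ _ xpredT i e) //; last first.
  move=> d; rewrite andbT ie; apply/andP/idP => [[/dvdnP[k kE]]|de].
    have d0 : (0 < d)%N by case: d kE i0; rewrite // muln0 -ie => ->.
    rewrite kE mulnK // => /dvdnP[k' k'E]; apply/dvdnP; exists k'.
    by apply/eqP; rewrite -(eqn_pmul2r l0) kE k'E mulnAC.
  by rewrite dvdn_mulr // -divn_mulAC // dvdn_mull.
have liE : (l == i) = (e == 1)%N.
  by rewrite ie -{1}(mul1n l) eqn_pmul2r // eq_sym.
have l2iE : (l.*2 == i) = (e == 2)%N.
  by rewrite ie -mul2n eqn_pmul2r // eq_sym.
rewrite liE l2iE; transitivity (((-1) ^+ b * U) ^+ (m * e) *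
    \sum_(d <- divisors e) (mobius d)%:~R * ((-1) ^+ b) ^+ (e %/ d)).
  rewrite mulr_sumr [LHS]big_seq [RHS]big_seq; apply: eq_bigr => d.
  rewrite -dvdn_divisors // => de.
  have -> : (i %/ d %/ l = e %/ d)%N by rewrite ie -divn_mulAC // mulnK.
  have -> : (m * e = d * m * (e %/ d))%N by rewrite mulnAC [(d * _)%N]mulnC divnK // mulnC.
  move: ((-1) ^+ b) => v; rewrite exprMn -exprM.
  by rewrite mulrA mulrC.
case: b.
  rewrite !expr1 mulN1r.
  have -> : \sum_(d <- divisors e) (mobius d)%:~R * (-1) ^+ (e %/ d) =
      - (e == 1%N)%:R + (e == 2%N)%:R *+ 2 :> R.
    have /(congr1 (fun k : int => k%:~R : R)) := sum_mobius_sign e0.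
    have -> : (- (e == 1%N)%:R + (e == 2%N)%:R *+ 2)%:~R =
        - (e == 1%N)%:R + (e == 2%N)%:R *+ 2 :> R.
      by rewrite rmorphD rmorphN !rmorphMn !rmorph1.
    rewrite rmorph_sum /= => <-.
    by apply: eq_bigr => d _; rewrite rmorphM rmorphXn rmorphN1.
  have [->|e1] := eqVneq e 1%N.
    by rewrite muln1 /= mul0rn !addr0 mulrN1.
  have [->|e2] := eqVneq e 2%N.
    by rewrite muln2 oppr0 !add0r mulr_natr -mul2n exprM sqrrN -exprM mul2n !mulr1n.
  by rewrite !mulr0n !mul0rn oppr0 !addr0 mulr0.
under eq_bigr => d _ do rewrite expr0 expr1n mulr1.
rewrite -rmorph_sum sum_mobius // rmorph_nat expr0 mul1r.
by case: eqP => [->|_]; rewrite ?muln1 ?mulr1 ?mulr0.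
Qed.

Definition necklace_dlog C : fps R :=
  let c := necklace_wt u C * z #|C| in
  let c2 := necklace_wt u C ^+ 2 * z #|C|.*2 in
  if necklace_odd C then - dlog_geom (- c) #|C| + dlog_geom c2 #|C|.*2
  else dlog_geom c #|C|.

(** An even necklace contributes 1/(1 - c x^l), an odd one
    (1 + c x^l)/(1 - c' x^(2l)). *)
Lemma euler_local_series C : C \in porbits T ->
  euler (local_series u z C) = necklace_dlog C * local_series u z C.
Proof.
move=> CT; have l0 := card_necklace_gt0 CT; rewrite /necklace_dlog.
set c := _ * z #|C|; set c2 := _ * z #|C|.*2.
case: ifP => od.
  have -> : local_series u z C = (1 + fpsC c * fpsX R ^+ #|C|) * geom c2 #|C|.*2.
    apply: fpsP => h; rewrite fcoef_short_long //= /local_wt /short_cycles /long_cycles od.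
    case: ifP => // _; move: (h %/ #|C|)%N => m.
    rewrite /c /c2; move: (necklace_wt u C) => U.
    rewrite (exprMn _ U) (exprMn _ (U ^+ 2)) -exprM.
    rewrite mulrACA -exprD; congr (U ^+ _ * _).
    by rewrite -[in LHS](odd_double_half m) -mul2n.
  rewrite eulerM euler_1DX // euler_geom ?double_gt0 //.
  rewrite [RHS]mulrDl; congr (_ + _); first by rewrite mulrA.
  exact: mulrCA.
have -> : local_series u z C = geom c #|C|; last exact: euler_geom.
apply: fpsP => h; rewrite /= /local_wt /short_cycles /long_cycles od.
by case: ifP => // _; rewrite expr0 mulr1 /c exprMn.
Qed.

(** The factor l produced by x d/dx makes the sum over necklaces a sum over
    periodic sequences. *)
Lemma fcoef_necklace_dlog C j : C \in porbits T -> (0 < j)%N ->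
  fcoef (necklace_dlog C) j =
  \sum_(s in C) \sum_(1 <= i < j.+1 | (i %| j)%N)
     z i ^+ (j %/ i) * necklace_coef C i (j %/ i).
Proof.
move=> CT j0; have l0 := card_necklace_gt0 CT.
rewrite sumr_const /necklace_dlog /necklace_coef.
move: l0 (necklace_wt u C); set l := #|C| => l0 U.
have pick i0 (F : nat -> R) : (0 < i0)%N ->
    \sum_(1 <= i < j.+1 | (i %| j)%N) F i *+ (i0 == i) =
    if (i0 %| j)%N then F i0 else 0.
  move=> i00; rewrite big_mkcond; case: ifP => d.
    have ij : (i0 <= j)%N by apply: dvdn_leq.
    rewrite (bigD1_seq i0) ?iota_uniq ?mem_index_iota ?i00 //= d eqxx mulr1n.
    rewrite big1 ?addr0 // => i ii0; rewrite eq_sym (negbTE ii0).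
    by rewrite mulr0n; case: ifP.
  by rewrite big1 // => i _; case: ifP => // di; case: eqP => // E; rewrite E di in d.
case: ifP => od.
  rewrite fcoefD fcoefN /= j0 /=.
  under eq_bigr => i _.
    have -> : z i ^+ (j %/ i) * (- ((- U) ^+ (j %/ i) *+ (l == i)) +
                    U ^+ (j %/ i).*2 *+ (l.*2 == i) *+ 2) =
       - ((- (U * z i)) ^+ (j %/ i) *+ (l == i)) +
       (U ^+ 2 * z i) ^+ (j %/ i) *+ 2 *+ (l.*2 == i).
      rewrite -mulNr !(exprMn _ _ (z i)) -exprM mul2n mulrDr mulrN !mulrnAr.
      by rewrite -!mulrnA [(2 * _)%N]mulnC ![z i ^+ _ * _]mulrC.
    over.
  rewrite big_split /= sumrN !pick ?double_gt0 // mulrnDl mulNrn.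
  congr (- _ + _); case: ifP; rewrite ?mul0rn //.
  by rewrite -mulrnA mul2n.
under eq_bigr => i _ do rewrite mulrnAr mulrC -exprMn.
by rewrite pick //= j0 /=; case: ifP; rewrite ?mul0rn.
Qed.

Lemma fcoef_sum_necklace_dlog j : (0 < j)%N -> (j <= n)%N ->
  fcoef (\sum_(C in porbits T) necklace_dlog C) j =
  \sum_(1 <= i < j.+1 | (i %| j)%N) z i ^+ (j %/ i) * cycle_coef i (j %/ i).
Proof.
move=> j0 jn; rewrite (big_morph (fun f : fps R => fcoef f j) (id1 := 0) (op1 := +%R)) //.
rewrite (eq_bigr _ (fun C CT => fcoef_necklace_dlog CT j0)).
rewrite (eq_bigr (fun C => \sum_(s in C) \sum_(1 <= i < j.+1 | (i %| j)%N)
     z i ^+ (j %/ i) * necklace_coef (porbit T s) i (j %/ i))); last first.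
  move=> C /imsetP[s0 _ ->]; apply: eq_bigr => s.
  by rewrite -eq_porbit_mem => /eqP->.
rewrite -(sum_porbits T (fun s => \sum_(1 <= i < j.+1 | (i %| j)%N)
     z i ^+ (j %/ i) * necklace_coef (porbit T s) i (j %/ i))).
rewrite exchange_big /= [LHS]big_nat_cond [RHS]big_nat_cond.
apply: eq_bigr => i /andP[/andP[i0 ij] d].
rewrite cycle_coefE // ?mulr_sumr //.
by rewrite dvdn_fact // i0 (leq_trans _ jn).
Qed.

End PowerSums.

(** * The Gessel-Reutenauer generating function *)

Section GesselReutenauer.
Variables n r : nat.
Local Notation N := n`!.
Local Notation T := (shift N r).
Local Notation word := {ffun 'I_N -> 'I_r}.

Lemma int_torsion_free : torsion_free int.
Proof. by move=> m a /eqP; rewrite -mulr_natr mulf_eq0 Num.Theory.pnatr_eq0 orbF => /eqP. Qed.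

(** With all weights equal to 1 the generating function of multisets of
    necklaces is the product of the 1/(1 - x^l).  The coefficient of x^j in its
    logarithmic derivative is the number of sequences with period dividing j,
    which is r^j, just as for 1/(1 - r x). *)
Lemma card_valid_data : #|valid_data n r| = (r ^ n)%N.
Proof.
pose G := \prod_(C in porbits T) geom (1 : int) #|C|.
have GE : G = \prod_(C in porbits T) local_series (fun=> 1 : int) (fun=> 1) C.
  apply: eq_bigr => C _; apply: fpsP => h /=; rewrite /local_wt /necklace_wt.
  by rewrite big1 // !expr1n !mulr1.
have : fcoef G n = #|valid_data n r|%:R.
  rewrite GE fcoef_prod_local (eq_bigr (fun=> 1)).
    by rewrite sumr_const.
  move=> h _; rewrite big1 // => C _; rewrite /local_wt /necklace_wt.
  by rewrite big1 // !expr1n !mulr1.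
rewrite (@euler_inj _ n.+1 G (geom r%:R 1)
  (\sum_(C in porbits T) dlog_geom 1 #|C|) (dlog_geom r%:R 1)) //.
- by rewrite /= dvd1n divn1 -natrX => /eqP; rewrite Num.Theory.eqr_nat => /eqP.
- exact: int_torsion_free.
- move=> j jn.
  rewrite (big_morph (fun f : fps int => fcoef f j) (id1 := 0) (op1 := +%R)) //=.
  rewrite dvd1n andbT divn1 mulr1n; case: posnP => [->|j0] /=.
    by rewrite big1.
  have := @power_sum n r int (fun=> 1) j j0.
  rewrite dvdn_fact ?j0 // => /(_ isT); rewrite sumr_const card_ord => ->.
  rewrite [RHS]big_mkcond (sum_porbits T) /=; apply: eq_bigr => C /imsetP[s0 _ ->].
  rewrite (eq_bigr (fun=> if (#|porbit T s0| %| j)%N then 1 else 0)).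
    by rewrite sumr_const expr1n; case: ifP; rewrite ?mul0rn.
  move=> s; rewrite -eq_porbit_mem => /eqP ->.
  by rewrite big1 // expr1n.
- rewrite (big_morph (fun f : fps int => fcoef f 0) (id1 := 0) (op1 := +%R)) //=.
  by rewrite big1.
- by apply: euler_prod => C CT; apply: euler_geom; apply: card_necklace_gt0 CT.
- exact: euler_geom.
rewrite geom0 (big_morph (fun f : fps int => fcoef f 0) (id1 := 1) (op1 := *%R)) //.
  by rewrite big1 // => C _; rewrite geom0.
exact: fcoefM0.
Qed.

Variables (R : comNzRingType) (u : 'I_r -> R) (z : nat -> R).

Definition compatible_sum : R :=
  \sum_(pf in compatible_pairs n r)
    (\prod_x u (pf.2 x)) * \prod_(1 <= i < n.+1) z i ^+ Ncyc pf.1 i.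

Lemma compatible_sumE :
  compatible_sum = fcoef (\prod_(C in porbits T) local_series u z C) n.
Proof.
rewrite fcoef_prod_local -(occ_data_onto card_valid_data).
rewrite big_imset; last exact: occ_data_inj.
apply: eq_bigr => pf; rewrite inE => pfc.
rewrite (compatible_wt _ _ pfc) big_sub; apply: eq_bigr => C _.
by rewrite occ_dataE.
Qed.

Lemma fcoef_local_prod0 :
  fcoef (\prod_(C in porbits T) local_series u z C) 0 = 1.
Proof.
rewrite (big_morph (fun f : fps R => fcoef f 0) (id1 := 1) (op1 := *%R)) //.
  rewrite big1 // => C _ /=; rewrite dvdn0 div0n /local_wt /short_cycles /long_cycles.
  by case: ifP; rewrite !expr0 !mulr1.
exact: fcoefM0.
Qed.

Lemma euler_local_prod :
  euler (\prod_(C in porbits T) local_series u z C) =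
  (\sum_(C in porbits T) necklace_dlog u z C) * \prod_(C in porbits T) local_series u z C.
Proof. by apply: euler_prod => C; apply: euler_local_series. Qed.

End GesselReutenauer.

(** * Expansions in x and t *)

Lemma fcoef_monomial (R : comNzRingType) (c : R) k n :
  fcoef (fpsC c * fpsX R ^+ k) n = c *+ (k == n).
Proof.
rewrite fcoefCM -[fpsX R ^+ k]mulr1 fcoefXnM fcoef1 subn_eq0.
by case: (ltngtP k n) => _; rewrite ?mulr0 ?mulr1.
Qed.

Section SeriesTools.
Variable R : comNzRingType.
Hypothesis natR : nat_invertible R.
Local Notation B := (fps (fps R)).

Lemma eq_fps_series a (F G : nat -> B) :
  (forall i, (a <= i)%N -> F i = G i) ->
  \sum_(a <= i <oo) F i = \sum_(a <= i <oo) G i.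
Proof.
move=> FG; congr fps_lim; apply/funext => N; apply: eq_big_nat => i /andP[ai _].
exact: FG.
Qed.

Lemma eq_fps_infprod a (F G : nat -> B) :
  (forall i, (a <= i)%N -> F i = G i) ->
  \prod_(a <= i <oo) F i = \prod_(a <= i <oo) G i.
Proof.
move=> FG; congr fps_lim; apply/funext => N; apply: eq_big_nat => i /andP[ai _].
exact: FG.
Qed.

Lemma monomial_series (a : nat -> fps R) i : (0 < i)%N ->
  \sum_(1 <= m <oo) (fpsC (a m) * fpsX (fps R) ^+ (i * m)) =
  Fps (fun j => if (0 < j)%N && (i %| j)%N then a (j %/ i)%N else 0).
Proof.
move=> i0; apply: fps_limP => N n nN; rewrite fcoef_sum [RHS]/=.
have tE m : fcoef (fpsC (a m) * fpsX (fps R) ^+ (i * m)) n = a m *+ (i * m == n)%N.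
  exact: fcoef_monomial.
under eq_bigr => m _ do rewrite tE.
case: ifP => [/andP[n0 /dvdnP[m E]]|H].
  have m0 : (0 < m)%N by case: m E n0 => // ->.
  rewrite (bigD1_seq m) ?iota_uniq ?mem_index_iota ?m0 //=; last first.
    by apply: leq_ltn_trans nN; rewrite E leq_pmulr.
  rewrite E mulnK // mulnC eqxx mulr1n big1 ?addr0 // => m' mm'.
  by rewrite mulnC eqn_pmul2r // (negbTE mm').
rewrite big1_seq // => m /andP[_]; rewrite mem_index_iota => /andP[m0 _].
case: eqP => // E; move: H; rewrite -E muln_gt0 i0 m0 dvdn_mulr //.
Qed.

Let torsA := nat_invertible_torsion_free (nat_invertible_fps natR).

Lemma fps_exp_feq1 i (f : B) : fcoef f 0 = 0 -> feq i (euler f) 0 ->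
  feq i (fps_exp f) 1.
Proof.
move=> f0 ef; apply: (euler_inj (L := euler f) (L' := 0)) => //.
- exact: euler_exp.
- by rewrite euler1 mul0r.
- by rewrite fps_exp0 // fcoef1.
Qed.

Lemma euler_exp_prod (f : nat -> B) :
  (forall i, (1 <= i)%N -> fcoef (f i) 0 = 0) ->
  (forall i, (1 <= i)%N -> feq i (euler (f i)) 0) ->
  euler (\prod_(1 <= i <oo) fps_exp (f i)) =
    Fps (fun n => \sum_(1 <= i < n.+1) fcoef (euler (f i)) n)
    * \prod_(1 <= i <oo) fps_exp (f i).
Proof.
move=> f0 ef; rewrite (fps_infprod_euler (L := fun i => euler (f i))) //.
- by congr (_ * _); apply: fpsP => n; rewrite /= fcoef_sum.
- by move=> i i1; apply: fps_exp_feq1; [apply: f0 | apply: ef].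
- by move=> i i1; apply: euler_exp => //; apply: f0.
Qed.

Lemma exp_prod0 (f : nat -> B) :
  (forall i, (1 <= i)%N -> fcoef (f i) 0 = 0) ->
  (forall i, (1 <= i)%N -> feq i (euler (f i)) 0) ->
  fcoef (\prod_(1 <= i <oo) fps_exp (f i)) 0 = 1.
Proof.
move=> f0 ef; rewrite -(@fps_infprod_feq _ 1 (fun i => fps_exp (f i)) _ 1%N) //.
  by rewrite big_geq // fcoef1.
by move=> i i1; apply: fps_exp_feq1; [apply: f0 | apply: ef].
Qed.

(** A series in x alone, seen as a series in x and t. *)
Definition fps_lift (f : fps R) : B := Fps (fun n => fpsC (fcoef f n)).

Lemma euler_fps_lift f : euler (fps_lift f) = fps_lift (euler f).
Proof. by apply: fpsP => n; rewrite /= -rmorphMn. Qed.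

Lemma fps_liftM f g : fps_lift (f * g) = fps_lift f * fps_lift g.
Proof.
apply: fpsP => n; rewrite [RHS]fcoefM [LHS]/= rmorph_sum.
by apply: eq_bigr => j _; rewrite /= rmorphM.
Qed.

Lemma natV_fpsC n : (0 < n)%N -> (n%:R : B)^-1 = fpsC ((n%:R : fps R)^-1).
Proof.
move=> n0; rewrite rmorphV ?rmorph_nat //.
exact: nat_unit (nat_invertible_fps natR) n0.
Qed.

Lemma sum_tpow_series (P : nat -> B) (e : nat -> nat -> R) :
  (forall n k, fcoef (P k) n = fpsC (e n k)) ->
  \sum_(0 <= k <oo) (fpsC (fpsX R) ^+ k * P k) = Fps (fun n => Fps (e n)).
Proof.
move=> PE; apply: fps_cvg_lim => n m; exists m.+1 => N mN.
rewrite !fcoef_sum /=.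
have tE k : fcoef (fcoef (fpsC (fpsX R) ^+ k * P k) n) m = e n k *+ (k == m).
  by rewrite -rmorphXn fcoefCM PE mulrC fcoef_monomial.
under eq_bigr => k _ do rewrite tE.
rewrite (bigD1_seq m) ?iota_uniq ?mem_index_iota //= eqxx mulr1n.
by rewrite big1 ?addr0 // => k km; rewrite (negbTE km).
Qed.

Lemma sum_xpow_series (h : fps R) (g : nat -> fps R) :
  fpsC h + \sum_(1 <= n <oo) (fpsC (g n) * fpsX (fps R) ^+ n) =
  Fps (fun n => if n is 0 then h else g n).
Proof.
have := monomial_series g (ltnSn 0); under [X in X = _]eq_fps_series => n _ do rewrite mul1n.
move=> ->; apply: fpsP => -[|n] /=; first by rewrite addr0.
by rewrite add0r dvd1n divn1.
Qed.

End SeriesTools.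

(** * The identity for left peaks and descents *)

Lemma rmorph_F_lpk_des (S S' : comNzRingType) (phi : {rmorphism S -> S'}) n
    (y t : S) (z : nat -> S) :
  F_lpk_des n (phi y) (phi t) (fun i => phi (z i)) = phi (F_lpk_des n y t z).
Proof.
rewrite /F_lpk_des rmorph_sum; apply: eq_bigr => p _.
rewrite !rmorphM !rmorphXn rmorph_prod; congr (_ * _).
by apply: eq_bigr => i _; rewrite rmorphXn.
Qed.

Lemma F_lpk_des1 (S : comNzRingType) n (y : S) z : F_lpk_des n y 1 z = F_lpk n y z.
Proof. by apply: eq_bigr => p _; rewrite expr1n mulr1. Qed.

Section Main.
Variable R : comNzRingType.
Hypothesis natR : nat_invertible R.
Variables (y : R) (z : nat -> R).
Hypothesis uy : exists y', y' * y = 1.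
Local Notation B := (fps (fps R)).
Local Notation t := (fpsX R).
Local Notation c := (fpsC y).
Local Notation tt := (fpsC (fpsX R) : B).
Local Notation yy := (fpsC (fpsC y) : B).
Local Notation xx := (fpsX (fps R)).
Local Notation zz := (fun i => fpsC (fpsC (z i)) : B).

Definition letter_wt k (a : 'I_k.*2.+1) : R := parity_wt y a.

(** The coefficient of x^n t^k on both sides. *)
Definition bi_coef n k : R := compatible_sum n (@letter_wt k) z.

(** There are k + 1 even letters of weight 1 and k odd letters of weight y. *)
Lemma signed_power_sumE k q :
  signed_power_sum (@letter_wt k) q = 1 + k%:R * (1 - (- y) ^+ q).
Proof.
rewrite /signed_power_sum /signed_wt /letter_wt.
elim: k => [|k IHk].
  by rewrite big_ord1 /parity_wt /= !expr0 !mul1r expr1n mul0r addr0.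
rewrite doubleS 2!big_ord_recr /= IHk /parity_wt /= odd_double /= !expr0 !expr1 !mul1r expr1n.
by rewrite !mulN1r -natr1; ring.
Qed.

Lemma bi_coef0 k : bi_coef 0 k = 1.
Proof. by rewrite /bi_coef compatible_sumE fcoef_local_prod0. Qed.

Lemma bi_coef_lhs n k : (0 < n)%N ->
  fcoef ((1 + c * t) ^+ n / (1 - t) ^+ n.+1
         * F_lpk_des n (lpk_arg y) (des_arg y) (fun i => fpsC (z i))) k
  = bi_coef n k.
Proof.
case: n => // n _; rewrite /F_lpk_des mulr_sumr fcoef_sum.
rewrite /bi_coef /compatible_sum /compatible_pairs.
rewrite (eq_bigl (fun pf : 'S_n.+1 * {ffun 'I_n.+1 -> 'I_k.*2.+1} =>
  compatible pf.1 pf.2)); last by move=> pf; rewrite inE.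
rewrite -(pair_big_dep xpredT
  (fun p (f : {ffun 'I_n.+1 -> 'I_k.*2.+1}) => compatible p f)
  (fun p (f : {ffun 'I_n.+1 -> 'I_k.*2.+1}) =>
    \prod_x letter_wt (f x) * \prod_(1 <= i < n.+2) z i ^+ Ncyc p i)).
apply: eq_bigr => p _; rewrite -mulr_suml sum_compatible //.
have -> : \prod_(1 <= i < n.+2) fpsC (z i) ^+ Ncyc p i =
          fpsC (\prod_(1 <= i < n.+2) z i ^+ Ncyc p i).
  by rewrite rmorph_prod; apply: eq_bigr => i _; rewrite rmorphXn.
rewrite [in LHS]mulrA; set A := (_ * (lpk_arg y ^+ _ * _)).
by rewrite [A * _]mulrC fcoefCM mulrC.
Qed.

Lemma lhs_series (term : nat -> B) :
  (forall n, (0 < n)%N -> term n = fpsC ((1 + c * t) ^+ n / (1 - t) ^+ n.+1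
         * F_lpk_des n (lpk_arg y) (des_arg y) (fun i => fpsC (z i)))) ->
  (1 - tt)^-1 + \sum_(1 <= n <oo) (term n * xx ^+ n) =
  Fps (fun n => Fps (bi_coef n)).
Proof.
move=> tE; rewrite (eq_fps_series (G := fun n => fpsC ((1 + c * t) ^+ n / (1 - t) ^+ n.+1
   * F_lpk_des n (lpk_arg y) (des_arg y) (fun i => fpsC (z i))) * xx ^+ n)); last first.
  by move=> n n0; rewrite tE.
have -> : (1 - tt)^-1 = fpsC ((1 - t)^-1).
  by rewrite rmorphV ?geom_unit // rmorphB rmorph1.
rewrite sum_xpow_series; apply: fpsP => -[|n]; apply: fpsP => k; last first.
  exact: bi_coef_lhs.
rewrite [RHS]/= bi_coef0 /= -[_^-1]mul1r (fcoef_geom (u := fun=> 1)) ?fcoef1 //.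
by move=> b; rewrite fcoef1 addr0.
Qed.

(** The logarithmic derivative determines the series.  The necklace product
    depends on n, through the common period n!, and is compared with P only up
    to degree n. *)
Lemma bi_coef_rhs k (P L : B) :
  fcoef P 0 = 1 -> euler P = L * P -> fcoef L 0 = 0 ->
  (forall j, (0 < j)%N -> fcoef L j = \sum_(1 <= i < j.+1 | (i %| j)%N)
     fpsC (z i ^+ (j %/ i) * cycle_coef (@letter_wt k) i (j %/ i))) ->
  forall n, fcoef P n = fpsC (bi_coef n k).
Proof.
move=> P0 PL L0 LE n; rewrite /bi_coef compatible_sumE.
set G := \prod_(C in _) _.
have GL := euler_local_prod n (@letter_wt k) z; rewrite -/G in GL.
rewrite -[RHS]/(fcoef (fps_lift G) n).
apply: (@euler_inj _ n.+1 P (fps_lift G) L (fps_lift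
  (\sum_(C in porbits (shift n`! k.*2.+1)) necklace_dlog (@letter_wt k) z C)))
  => //.
- exact: nat_invertible_torsion_free (nat_invertible_fps natR).
- move=> [|j] jn.
    rewrite L0 /= (big_morph (fun f : fps R => fcoef f 0) (id1 := 0) (op1 := +%R)) //.
    rewrite big1 ?rmorph0 // => C _; rewrite /necklace_dlog.
    by case: ifP => _ //=; rewrite oppr0 addr0.
  by rewrite LE //= fcoef_sum_necklace_dlog // rmorph_sum.
- by rewrite euler_fps_lift GL fps_liftM.
- by rewrite /= fcoef_local_prod0 P0.
Qed.

Lemma cycle_coef_letter k i m :
  cycle_coef (@letter_wt k) i m = \sum_(d <- divisors i) (mobius d)%:~R
     * (1 + k%:R * (1 - (- y) ^+ (d * m))) ^+ (i %/ d).
Proof. by apply: eq_bigr => d _; rewrite signed_power_sumE. Qed.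

Definition cycle_exponent k i : B :=
  \sum_(1 <= m <oo)
    ((zz i * xx ^+ i) ^+ m / (i * m)%:R
     * \sum_(d <- divisors i) (mobius d)%:~R
         * (1 + k%:R * (1 - (- yy) ^+ (d * m))) ^+ (i %/ d)).

Lemma cycle_exponentE k i : (0 < i)%N ->
  cycle_exponent k i = Fps (fun j => if (0 < j)%N && (i %| j)%N then
     fpsC (z i ^+ (j %/ i) * cycle_coef (@letter_wt k) i (j %/ i)) * j%:R^-1 else 0).
Proof.
move=> i0; pose a m := fpsC (z i ^+ m * cycle_coef (@letter_wt k) i m) * (i * m)%:R^-1.
transitivity (\sum_(1 <= m <oo) (fpsC (a m) * xx ^+ (i * m))).
  apply: eq_fps_series => m m0.
  have -> : \sum_(d <- divisors i) (mobius d)%:~R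
         * (1 + k%:R * (1 - (- yy) ^+ (d * m))) ^+ (i %/ d) =
     fpsC (fpsC (cycle_coef (@letter_wt k) i m)).
    rewrite cycle_coef_letter !rmorph_sum; apply: eq_bigr => d _.
    rewrite !(rmorphM, rmorph_int, rmorphXn, rmorphD, rmorph1, rmorph_nat, rmorphN) //.
  rewrite natV_fpsC ?muln_gt0 ?i0 // /a; move: (_%:R^-1) => v.
  rewrite !rmorphM !rmorphXn exprMn -exprM -!mulrA; congr (_ * _).
  by rewrite mulrCA [RHS]mulrCA; congr (_ * _); exact: mulrC.
rewrite monomial_series //; apply: fpsP => j /=; case: ifP => // /andP[_ ij].
by rewrite /a [(i * _)%N]mulnC divnK.
Qed.


(** The exponent of the i-th factor in (a), with its terms collected by powers
    of x. *)
Definition log_cycle_series k i : B :=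
  Fps (fun j => if (0 < j)%N && (i %| j)%N then
     fpsC (z i ^+ (j %/ i) * cycle_coef (@letter_wt k) i (j %/ i)) * j%:R^-1 else 0).

Lemma euler_log_cycle_series k i j : fcoef (euler (log_cycle_series k i)) j =
  if (0 < j)%N && (i %| j)%N then
     fpsC (z i ^+ (j %/ i) * cycle_coef (@letter_wt k) i (j %/ i)) else 0.
Proof.
set v := fpsC _; rewrite fcoef_euler.
have -> : fcoef (log_cycle_series k i) j =
    if (0 < j)%N && (i %| j)%N then v * j%:R^-1 else 0 by [].
move: v => v; case: ifP => [/andP[j0 _]|]; last by rewrite mul0rn.
rewrite -[LHS]mulr_natr -mulrA mulVr ?mulr1 //.
exact: nat_unit (nat_invertible_fps natR) j0.
Qed.

Lemma exp_cycle_prod k n :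
  fcoef (\prod_(1 <= i <oo) fps_exp (log_cycle_series k i)) n = fpsC (bi_coef n k).
Proof.
have f0 i : (1 <= i)%N -> fcoef (log_cycle_series k i) 0 = 0 by [].
have ef i : (1 <= i)%N -> feq i (euler (log_cycle_series k i)) 0.
  move=> i1 j ji; rewrite euler_log_cycle_series.
  by case: ifP => // /andP[j0 /(dvdn_leq j0)]; rewrite leqNgt ji.
apply: bi_coef_rhs (euler_exp_prod natR f0 ef) _ _ n.
- exact: exp_prod0.
- by rewrite /= big_geq.
move=> j j0; rewrite [RHS]big_mkcond.
rewrite -[LHS]/(\sum_(1 <= i < j.+1) fcoef (euler (log_cycle_series k i)) j).
by apply: eq_bigr => i _; rewrite euler_log_cycle_series j0.
Qed.

Lemma rhs_des :
  \sum_(0 <= k <oo)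
    (tt ^+ k * \prod_(1 <= i <oo) fps_exp (cycle_exponent k i))
  = Fps (fun n => Fps (bi_coef n)).
Proof.
pose P k : B := \prod_(1 <= i <oo) fps_exp (log_cycle_series k i).
transitivity (\sum_(0 <= k <oo) (tt ^+ k * P k)).
  have PE k : \prod_(1 <= i <oo) fps_exp (cycle_exponent k i) = P k.
    exact: eq_fps_infprod (fun i i1 => congr1 (@fps_exp R) (cycle_exponentE k i1)).
  exact: eq_fps_series (fun k _ => congr1 ( *%R (tt ^+ k)) (PE k)).
exact: (@sum_tpow_series R P bi_coef (fun n k => exp_cycle_prod k n)).
Qed.

Lemma lhs_des :
  (1 - tt)^-1
  + \sum_(1 <= n <oo)
      ((1 + yy * tt) ^+ n / (1 - tt) ^+ n.+1
       * F_lpk_des n ((1 + yy) ^+ 2 * tt / ((yy + tt) * (1 + yy * tt)))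
                     ((yy + tt) / (1 + yy * tt)) zz
       * xx ^+ n)
  = Fps (fun n => Fps (bi_coef n)).
Proof.
apply: lhs_series => n n0.
have u1 := one_yt_unit y; have u2 := yDt_unit uy; have u3 := geom_unit R.
have n1E : fpsC (1 + c * t) = 1 + yy * tt by rewrite rmorphD rmorph1 rmorphM.
have n2E : fpsC (1 - t) = 1 - tt by rewrite rmorphB rmorph1.
have n3E : fpsC (c + t) = yy + tt by rewrite rmorphD.
have n4E : fpsC ((1 + c) ^+ 2 * t) = (1 + yy) ^+ 2 * tt.
  by rewrite rmorphM rmorphXn rmorphD rmorph1.
have desE : (yy + tt) / (1 + yy * tt) = fpsC (des_arg y).
  by rewrite -n1E -n3E -rmorph_div.
have u12 : (c + t) * (1 + c * t) \is a GRing.unit by rewrite unitrM u1 u2.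
have lpkE : (1 + yy) ^+ 2 * tt / ((yy + tt) * (1 + yy * tt)) = fpsC (lpk_arg y).
  by rewrite -n4E -n1E -n3E -rmorphM -rmorph_div.
rewrite desE lpkE (rmorph_F_lpk_des (@fpsC (fps R))) -n1E -n2E.
have u4 : (1 - t) ^+ n.+1 \is a GRing.unit by rewrite unitrX.
rewrite -(rmorphXn (@fpsC (fps R)) n) -(rmorphXn (@fpsC (fps R)) n.+1).
rewrite -(rmorph_div _ _ u4).
exact/esym/rmorphM.
Qed.

End Main.

Section MainLpk.
Variable R : comNzRingType.
Hypothesis natR : nat_invertible R.
Variable z : nat -> R.
Local Notation B := (fps (fps R)).
Local Notation t := (fpsX R).
Local Notation tt := (fpsC (fpsX R) : B).
Local Notation xx := (fpsX (fps R)).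
Local Notation zz := (fun i => fpsC (fpsC (z i)) : B).

Let u1 : exists y' : R, y' * 1 = 1. Proof. by exists 1; rewrite mulr1. Qed.

Lemma lhs_lpk :
  (1 - tt)^-1
  + \sum_(1 <= n <oo)
      ((1 + tt) ^+ n / (1 - tt) ^+ n.+1
       * F_lpk n (4%:R * tt / (1 + tt) ^+ 2) zz
       * xx ^+ n)
  = Fps (fun n => Fps (bi_coef 1 z n)).
Proof.
rewrite -(lhs_des z u1).
have c1 : fpsC (fpsC 1) = 1 :> B by rewrite !rmorph1.
have u : 1 + tt \is a GRing.unit.
  by have := fpsC_unit (one_yt_unit (1 : R)); rewrite rmorphD rmorphM !rmorph1 mul1r.
have E1 : (1 + fpsC (fpsC 1) * tt) = 1 + tt :> B by rewrite c1 mul1r.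
have E2 : (fpsC (fpsC 1) + tt) / (1 + fpsC (fpsC 1) * tt) = 1 :> B.
  by rewrite E1 c1 divrr.
have E3 : (1 + fpsC (fpsC 1)) ^+ 2 * tt /
    ((fpsC (fpsC 1) + tt) * (1 + fpsC (fpsC 1) * tt))
    = 4%:R * tt / (1 + tt) ^+ 2 :> B.
  rewrite E1 c1; have -> : (1 + 1) ^+ 2 = 4%:R :> B.
    by rewrite -[1 + 1]/(2%:R) -natrX.
  by rewrite -expr2.
rewrite E3 E2 E1; apply: (congr1 ( +%R _)); apply: eq_fps_series => n _.
by rewrite F_lpk_des1.
Qed.

(** [ratr] is not a ring morphism into an arbitrary unit ring; clearing the
    denominator of q avoids using it as one. *)
Lemma ratr_mul (S : comUnitRingType) (q : rat) (a b : int) :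
  q * a%:~R = b%:~R -> (forall d : nat, (0 < d)%N -> d%:R \is a @GRing.unit S) ->
  ratr q * a%:~R = b%:~R :> S.
Proof.
move=> qab nU; have d0 := denq_gt0 q.
have dU : (denq q)%:~R \is a @GRing.unit S.
  by case: (denq q) d0 => // d; rewrite ltz_nat => d0; exact: nU.
have : numq q * a = b * denq q.
  by apply: (@intr_inj rat); rewrite !rmorphM /= -qab numqE mulrAC.
move/(congr1 (fun k : int => k%:~R : S)); rewrite !rmorphM /= => E.
by rewrite /ratr mulrAC E mulrK.
Qed.

End MainLpk.

(** * The identity for left peaks *)

Definition is_pow2 i := [exists j : 'I_i, i == (2 ^ j)%N].

(** The integer 2 i h_{i,k}: when i is a power of 2, the sum over odd divisors
    reduces to d = 1. *)
Definition odd_cycle_count (i k : nat) : int :=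
  \sum_(d <- divisors i | odd d) mobius d * (1 + 2 * k%:R) ^+ (i %/ d)
  - (is_pow2 i)%:R.

(** When m is even, all powers in the sum equal 1 and the sum of mu remains.
    When m is odd, even d contribute mu(d) alone, and the sum of mu over the even
    divisors is that over all divisors minus that over the odd ones. *)
Lemma cycle_coef_int i m k : (0 < i)%N ->
  \sum_(d <- divisors i) mobius d * (1 + k%:R * (1 - (- 1) ^+ (d * m))) ^+ (i %/ d)
  = (i == 1%N)%:R + (if odd m then odd_cycle_count i k else 0) :> int.
Proof.
move=> i0; case: ifP => om; last first.
  rewrite addr0 -sum_mobius //; apply: eq_bigr => d _.
  by rewrite -signr_odd oddM om andbF expr0 subrr mulr0 addr0 expr1n mulr1.
rewrite (bigID odd) /= /odd_cycle_count -sum_mobius // [in RHS](bigID odd) /=.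
rewrite /is_pow2 -sum_mobius_odd //.
set A := \sum_(d <- _ | odd d) mobius d.
have -> (a b x : int) : a + b + (x - a) = x + b by ring.
congr (_ + _); apply: eq_bigr => d od; rewrite -signr_odd oddM om andbT.
  by rewrite od expr1 opprK [k%:R * _]mulrC.
by rewrite (negbTE od) expr0 subrr mulr0 addr0 expr1n mulr1.
Qed.

Lemma hexp_mul i k : (0 < i)%N ->
  hexp i k * (2 * i)%:R = (odd_cycle_count i k)%:~R.
Proof.
move=> i0; have n0 : (2 * i%:R : rat) != 0.
  by rewrite mulf_neq0 // Num.Theory.pnatr_eq0 -lt0n.
have -> : (2 * i)%:R = 2 * i%:R :> rat by rewrite natrM.
have HE : (odd_cycle_count i k)%:~R =
   \sum_(d <- divisors i | odd d) (mobius d)%:~R * (1 + 2 * k%:R) ^+ (i %/ d)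
    - (is_pow2 i)%:R :> rat.
  rewrite /odd_cycle_count rmorphB rmorph_sum /= mulrz_nat; congr (_ - _).
  apply: eq_bigr => d _; rewrite rmorphM rmorphXn rmorphD rmorphM /=.
  by rewrite !mulrz_nat.
rewrite HE /hexp /is_pow2; case: ifP => [/existsP[j /eqP ij]|_].
  rewrite divfK // (@big_divisors_eq _ odd xpredT i 1) // => [|d].
    by rewrite big_seq1 divn1 /= mul1r.
  rewrite andbT dvdn1 ij; apply/andP/eqP => [[/dvdn_pfactor]|->].
    by case=> // -[|e] _ -> //; rewrite oddX.
  by rewrite dvd1n.
by rewrite mulrAC mulVf // mul1r subr0.
Qed.

Section LpkSide.
Variable R : comNzRingType.
Hypothesis natR : nat_invertible R.
Variable z : nat -> R.
Local Notation B := (fps (fps R)).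
Local Notation tt := (fpsC (fpsX R) : B).
Local Notation xx := (fpsX (fps R)).
Local Notation zz := (fun i => fpsC (fpsC (z i)) : B).

Let natA n : (0 < n)%N -> n%:R \is a @GRing.unit (fps R).
Proof. exact: nat_unit (nat_invertible_fps natR). Qed.

Lemma cycle_coef_lpk i m k : (0 < i)%N ->
  fpsC (cycle_coef (@letter_wt R 1 k) i m) =
  (i == 1%N)%:R + (if odd m then ratr (hexp i k) * (2 * i)%:R else 0).
Proof.
move=> i0; have -> : ratr (hexp i k) * (2 * i)%:R = (odd_cycle_count i k)%:~R :> fps R.
  by apply: (ratr_mul (a := (2 * i)%N)) => //; apply: hexp_mul.
rewrite cycle_coef_letter.
have := congr1 (fun x : int => x%:~R : fps R) (cycle_coef_int m k i0).
rewrite rmorphD /= mulrz_nat => E.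
have -> : (if odd m then (odd_cycle_count i k)%:~R else 0) =
   (if odd m then odd_cycle_count i k else 0)%:~R :> fps R by case: ifP.
rewrite -E !rmorph_sum; apply: eq_bigr => d _.
by rewrite !(rmorphM, rmorphXn, rmorphD, rmorphN, rmorph1, rmorph_int) /= !rmorph_nat.
Qed.

Definition pow_exponent k i : B :=
  ratr (hexp i k) * fps_log ((1 + zz i * xx ^+ i) / (1 - zz i * xx ^+ i)).

Lemma ratr_fpsC (q : rat) : ratr q = fpsC (ratr q) :> B.
Proof.
rewrite /ratr rmorph_div ?rmorph_int //.
by case: (denq q) (denq_gt0 q) => // d; exact: natA.
Qed.

Lemma pow_base0 i : (0 < i)%N ->
  fcoef ((1 + zz i * xx ^+ i) / (1 - zz i * xx ^+ i)) 0 = 1.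
Proof.
move=> i0; rewrite fcoefM0 fcoefV0 ?fcoefD ?fcoefN fcoef_monomial fcoef1.
  by rewrite (gtn_eqF i0) mulr0n addr0 mulr1.
by rewrite (gtn_eqF i0) mulr0n subr0.
Qed.

Lemma euler_pow_base i : (0 < i)%N ->
  euler (fps_log ((1 + zz i * xx ^+ i) / (1 - zz i * xx ^+ i))) =
  - dlog_geom (- fpsC (z i)) i + dlog_geom (fpsC (z i)) i.
Proof.
move=> i0; rewrite euler_log ?pow_base0 //.
have g1 := geom_inv (fpsC (z i)) i0.
have uZ : 1 - zz i * xx ^+ i \is a GRing.unit.
  by apply/unitrP; exists (geom (fpsC (z i)) i); rewrite g1 mulrC g1.
have VE : (1 - zz i * xx ^+ i)^-1 = geom (fpsC (z i)) i.
  by apply: (mulrI uZ); rewrite divrr.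
have ug := fps_unit0 (pow_base0 i0); rewrite VE in ug *.
have -> : euler ((1 + zz i * xx ^+ i) * geom (fpsC (z i)) i) =
   (- dlog_geom (- fpsC (z i)) i + dlog_geom (fpsC (z i)) i)
    * ((1 + zz i * xx ^+ i) * geom (fpsC (z i)) i).
  rewrite eulerM euler_1DX // euler_geom //.
  have distr (a b d e : B) : a * e * d + e * (b * d) = (a + b) * (e * d).
    by rewrite mulrDl (mulrCA e) -mulrA.
  exact: distr.
by rewrite mulrK.
Qed.

(** The logarithm of (1 + Z)/(1 - Z) contains only odd powers of Z. *)
Lemma fcoef_euler_pow_exponent k i j : (0 < i)%N -> (0 < j)%N ->
  fcoef (euler (pow_exponent k i)) j =
  if (i %| j)%N then fpsC (z i) ^+ (j %/ i) *
     (if odd (j %/ i) then ratr (hexp i k) * (2 * i)%:R else 0) else 0.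
Proof.
move=> i0 j0; rewrite /pow_exponent ratr_fpsC eulerCM fcoefCM euler_pow_base //.
move: (ratr _) (fpsC (z i)) => h c.
rewrite fcoefD fcoefN /= j0 /=; case: ifP => ij; last by rewrite oppr0 addr0 mulr0.
rewrite exprNn -signr_odd; case: odd; rewrite ?expr0 ?expr1 ?mul1r ?mulN1r.
  by rewrite mulNrn opprK -mulrnDr addnn -mul2n mulr_natr !mulrnAr mulrC.
by rewrite addNr !mulr0.
Qed.

(** The factor 1/(1 - z_1 x) supplies the terms with i = 1 that the exponents
    h_{1,k} lack. *)
Lemma pow_prod k n :
  fcoef ((1 - zz 1%N * xx)^-1 * \prod_(1 <= i <oo) fps_exp (pow_exponent k i)) n
  = fpsC (bi_coef 1 z n k).
Proof.
have f0 i : (1 <= i)%N -> fcoef (pow_exponent k i) 0 = 0.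
  by move=> i1; rewrite fcoefM0 fps_log0 ?mulr0 // pow_base0.
have ef i : (1 <= i)%N -> feq i (euler (pow_exponent k i)) 0.
  move=> i1 [|j] ji; first by rewrite fcoef_euler mulr0n.
  rewrite fcoef_euler_pow_exponent //; case: ifP => // /(dvdn_leq (ltn0Sn j)).
  by rewrite leqNgt ji.
have g1 := geom_inv (fpsC (z 1%N)) (ltnSn 0); rewrite expr1 in g1.
have uZ : 1 - zz 1%N * xx \is a GRing.unit.
  by apply/unitrP; exists (geom (fpsC (z 1%N)) 1); rewrite g1 mulrC g1.
have -> : (1 - zz 1%N * xx)^-1 = geom (fpsC (z 1%N)) 1.
  by apply: (mulrI uZ); rewrite divrr.
have P0 := exp_prod0 natR f0 ef; have PL := euler_exp_prod natR f0 ef.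
move: (\prod_(1 <= i <oo) _) P0 PL => P P0 PL.
set L := Fps _ in PL.
apply: (bi_coef_rhs natR (L := dlog_geom (fpsC (z 1%N)) 1 + L)).
- by rewrite fcoefM0 geom0 mul1r.
- by rewrite eulerM euler_geom // PL mulrDl -mulrA; congr (_ + _); rewrite mulrCA.
- by rewrite fcoefD /= big_geq // addr0.
move=> j j0; rewrite fcoefD -[fcoef L j]/(\sum_(1 <= i < j.+1) fcoef (euler (pow_exponent k i)) j).
rewrite [RHS]big_mkcond.
rewrite [RHS](eq_big_nat _ _ (F2 := fun i =>
  (if i == 1%N then fpsC (z i) ^+ (j %/ i) else 0)
  + fcoef (euler (pow_exponent k i)) j)); last first.
  move=> i /andP[i1 ij]; rewrite fcoef_euler_pow_exponent //; case: ifP => d.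
    have -> (a : R) m : fpsC (z i ^+ m * a) = fpsC (z i) ^+ m * fpsC a.
      by rewrite rmorphM rmorphXn.
    rewrite cycle_coef_lpk // mulrDr; congr (_ + _).
    by case: eqP; rewrite ?mulr1 ?mulr0.
  by case: eqP d => [->|_]; rewrite ?dvd1n ?addr0.
rewrite big_split /=; congr (_ + _).
rewrite (bigD1_seq 1%N) ?iota_uniq ?mem_index_iota //= j0 dvd1n /= mulr1n.
by rewrite big1 ?addr0 // => i /negbTE ->.
Qed.

Lemma rhs_lpk :
  \sum_(0 <= k <oo)
    (tt ^+ k / (1 - zz 1%N * xx) *
     \prod_(1 <= i <oo)
       fps_pow ((1 + zz i * xx ^+ i) / (1 - zz i * xx ^+ i)) (hexp i k))
  = Fps (fun n => Fps (bi_coef 1 z n)).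
Proof.
pose P k : B := (1 - zz 1%N * xx)^-1 * \prod_(1 <= i <oo) fps_exp (pow_exponent k i).
transitivity (\sum_(0 <= k <oo) (tt ^+ k * P k)).
  apply: eq_fps_series => k _; exact/esym/mulrA.
exact: (@sum_tpow_series R P (bi_coef 1 z) (fun n k => pow_prod k n)).
Qed.

End LpkSide.

(** * Specialization of the coefficient ring *)

(** The coefficients contain the field of rational functions in y, which has
    characteristic 0. *)
Lemma nat_invertible_Qyz : nat_invertible Qyz.
Proof.
move=> n; exists (malgC (n.+1%:R^-1 : Qy)).
rewrite -(rmorph_nat (@malgC (cmonom nat) Qy)) -rmorphM mulVf ?rmorph1 //.
rewrite -(rmorph_nat (@tofrac {poly rat})) tofrac_eq0 -polyC_natr.
by rewrite polyC_eq0 Num.Theory.pnatr_eq0.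
Qed.

Theorem theorem7p2 :
  let y := yvar in let t := tvar in let x := xvar in let z := zvar in
  ((1 - t)^-1
   + \sum_(1 <= n <oo)
       ((1 + y * t) ^+ n / (1 - t) ^+ n.+1
        * F_lpk_des n ((1 + y) ^+ 2 * t / ((y + t) * (1 + y * t)))
                      ((y + t) / (1 + y * t)) z
        * x ^+ n)
   = \sum_(0 <= k <oo)
       (t ^+ k *
        \prod_(1 <= i <oo)
          fps_exp (\sum_(1 <= m <oo)
            ((z i * x ^+ i) ^+ m / (i * m)%:R
             * \sum_(d <- divisors i) (mobius d)%:~R
                 * (1 + k%:R * (1 - (- y) ^+ (d * m))) ^+ (i %/ d)))))
  /\
  ((1 - t)^-1
   + \sum_(1 <= n <oo)
       ((1 + t) ^+ n / (1 - t) ^+ n.+1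
        * F_lpk n (4%:R * t / (1 + t) ^+ 2) z
        * x ^+ n)
   = \sum_(0 <= k <oo)
       (t ^+ k / (1 - z 1%N * x) *
        \prod_(1 <= i <oo)
          fps_pow ((1 + z i * x ^+ i) / (1 - z i * x ^+ i)) (hexp i k))).
Proof.
pose yc : Qyz := malgC (tofrac ('X : {poly rat})).
have uy : exists y' : Qyz, y' * yc = 1.
  exists (malgC ((tofrac ('X : {poly rat}))^-1)).
  rewrite -rmorphM mulVf ?rmorph1 //.
  by rewrite tofrac_eq0 polyX_eq0.
pose zc i : Qyz := mkmalgU (ucm i) (1 : Qy).
move=> y t x z; split.
  exact: etrans (lhs_des zc uy) (esym (rhs_des nat_invertible_Qyz yc zc)).
exact: etrans (lhs_lpk zc) (esym (rhs_lpk nat_invertible_Qyz zc)).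
Qed.
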